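(* For $n$ even, let $\vec p=\{p_{uv}:1\le u<v\le n\}$ and $\vec q=\{q_{iu}: i\in[n/2], u\in[n]\}$, and let $A_n(\vec p,\vec q)$ be the CNF consisting of the clauses $q_{i1}\vee\dots\vee q_{in}$ for $i\in[n/2]$; $\neg q_{iu}\vee\neg q_{ju}$ for $i<j$ in $[n/2]$, $u\in[n]$; $\neg q_{iu}\vee\neg q_{iv}$ for $i\in[n/2]$, $u<v$ in $[n]$; $\neg q_{iu}\vee\neg q_{jv}\vee p_{uv}$ for $i\ne j$ in $[n/2]$, $u<v$ in $[n]$. Thus for an assignment $\vec a$ to $\vec p$, $\exists\vec q.\,A_n(\vec a,\vec q)$ is true iff the $n$-vertex graph $G_{\vec a}$ with edge set $\{uv: a_{uv}=1\}$ has a clique of size $n/2$. Let $B_n(\vec p,\vec r_1,\vec r_2)$ be a polynomial-size CNF (with $\vec r_1,\vec r_2$ disjoint from $\vec p,\vec q$) obtained by encoding, with one existential variable in $\vec r_2$ per gate, a polynomial-size circuit that checks whether the set of $n/2$ vertices specified by $\vec r_1$ fails to form a clique in the graph given by $\vec p$, so that for every $\vec a$, $\forall\vec r_1\exists\vec r_2.\,B_n(\vec a,\vec r_1,\vec r_2)$ is true iff $G_{\vec a}$ has no clique of size $n/2$. Let $$\Phi_n=\exists\vec p\,\exists\vec q\,\forall\vec r_1\,\exists\vec r_2.\ A_n(\vec p,\vec q)\wedge B_n(\vec p,\vec r_1,\vec r_2).$$ Then every IRM-calc refutation and every LQU$^+$-Res refutation of $\Phi_n$ has size exponential in $n$.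
   Context: LQU$^+$-Res: lines are clauses possibly containing merged literals $u^*$ for universal $u$ ($\mathrm{ind}(u^* )=\mathrm{ind}(u)$, where $\mathrm{ind}$ is position in the prefix). Rules: (Axiom) matrix clauses; ($\forall$-Red) from $D\vee u$ or $D\vee u^*$ ($u$ universal) derive $D$ if $\mathrm{ind}(u)\ge\mathrm{ind}(l)$ for all existential $l\in D$; (Res) from $C_1\vee U_1\vee x$, $C_2\vee U_2\vee\neg x$ ($x$ existential or universal, not merged) derive $C_1\vee C_2\vee U$, provided: literals of $C_1,C_2$ on a common variable $z$ are equal and not $z^*$; $U_1,U_2$ contain only universal literals, $\mathrm{var}(U_1)=\mathrm{var}(U_2)$, $\mathrm{ind}(x)<\mathrm{ind}(u)$ for $u\in\mathrm{var}(U_1)$; literals $w_1\in U_1,w_2\in U_2$ on the same $u$ satisfy $w_1=\neg w_2$ or one of them is $u^*$; $U=\{u^*:u\in\mathrm{var}(U_1)\}$. IRM-calc: lines are clauses of annotated literals $l^\sigma$ ($l$ an existential literal, $\sigma$ a partial assignment into $\{0,1,*\}$ of universal variables of index $<\mathrm{ind}(l)$). $l^{[\sigma]}$ restricts $\sigma$ to variables of index $<\mathrm{ind}(l)$; $\tau\circ\mu$ agrees with $\tau$ on its domain and with $\mu$ elsewhere; $\mathrm{inst}(\tau,C)=\{l^{[\sigma\circ\tau]}:l^\sigma\in C\}$. Rules: (Axiom) for matrix clause $C$, derive $\{l^{[\tau]}: l\in C \text{ existential}\}$ where $\tau$ falsifies the universal literals of $C$; (Instantiation) from $C$ derive $\mathrm{inst}(\tau,C)$,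 $\tau$ into $\{0,1\}$; (Res) from $x^{\tau\cup\xi}\vee C_1$ and $\neg x^{\tau\cup\sigma}\vee C_2$, with mutually disjoint domains and $\mathrm{range}(\tau)\subseteq\{0,1\}$, derive $\mathrm{inst}(\sigma,C_1)\cup\mathrm{inst}(\xi,C_2)$; (Merging) from $C\vee b^\mu\vee b^\sigma$ with equal domains derive $C\vee b^\xi$, $\xi=\{c/u: c/u\in\mu\cap\sigma\}\cup\{*/u: c/u\in\mu,d/u\in\sigma,c\ne d\}$. A refutation is a derivation of the empty clause; size is the number of clauses. *)

(* Defs.v *)
From Stdlib Require Import List Arith Bool.
Import ListNotations.

(* Prenex CNF QBFs.  Variables are natural numbers; the prefix orders  *)
(* the variables by their number, so ind(x) = x (only comparisons of   *)
(* ind are ever used).  quniv x = true iff x is universally quantified.*)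
(* A literal (x,b) is x if b = true and ~x if b = false.               *)
Definition lit : Type := (nat * bool)%type.
Definition clause : Type := list lit.

Record QBF := mkQBF { quniv : nat -> bool; qmat : list clause }.

Inductive mlit := ML (x : nat) (b : bool) | MS (u : nat).
Definition mvar (l : mlit) : nat := match l with ML x _ => x | MS u => u end.
Definition mseteq (C D : list mlit) : Prop := forall l, In l C <-> In l D.

Definition lqu_red (F : QBF) (P D : list mlit) : Prop :=
  exists w, quniv F (mvar w) = true /\ mseteq P (w :: D) /\
    (forall x b, In (ML x b) D -> quniv F x = false -> x <= mvar w).

Definition lqu_res (F : QBF) (P1 P2 R : list mlit) : Prop :=
  exists (x : nat) (C1 U1 C2 U2 : list mlit),
    mseteq P1 (ML x true :: C1 ++ U1) /\
    mseteq P2 (ML x false :: C2 ++ U2) /\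
    (forall l, In l (C1 ++ U1 ++ C2 ++ U2) -> mvar l <> x) /\
    (forall l w, In l (C1 ++ C2) -> In w U1 -> mvar l <> mvar w) /\
    (forall l1 l2, In l1 C1 -> In l2 C2 -> mvar l1 = mvar l2 ->
        l1 = l2 /\ l1 <> MS (mvar l1)) /\
    (forall w, In w (U1 ++ U2) -> quniv F (mvar w) = true) /\
    (forall u, (exists w, In w U1 /\ mvar w = u) <-> (exists w, In w U2 /\ mvar w = u)) /\
    (forall w, In w U1 -> x < mvar w) /\
    (forall w1 w2, In w1 U1 -> In w2 U2 -> mvar w1 = mvar w2 ->
        (exists u b, w1 = ML u b /\ w2 = ML u (negb b)) \/
        w1 = MS (mvar w1) \/ w2 = MS (mvar w2)) /\
    mseteq R (C1 ++ C2 ++ map (fun w => MS (mvar w)) U1).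

Definition lqu_step (F : QBF) (prev : list (list mlit)) (C : list mlit) : Prop :=
  (exists D, In D (qmat F) /\ mseteq C (map (fun l => ML (fst l) (snd l)) D)) \/
  (exists P, In P prev /\ lqu_red F P C) \/
  (exists P1 P2, In P1 prev /\ In P2 prev /\ lqu_res F P1 P2 C).

(* a refutation: a sequence of lines, each derived from earlier ones,
   containing the empty clause; its size is its number of lines *)
Definition lqu_refutation (F : QBF) (pi : list (list mlit)) : Prop :=
  (forall i, i < length pi -> lqu_step F (firstn i pi) (nth i pi [])) /\
  In [] pi.

Inductive tri := T0 | T1 | TS.   (* 0, 1, * *)
Definition ann : Type := nat -> option tri.
Definition alit : Type := (nat * bool * ann)%type.
Definition aseteq (C D : list alit) : Prop := forall l, In l C <-> In l D.

Definition restrictA (x : nat) (s : ann) : ann :=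
  fun u => if u <? x then s u else None.
Definition compA (t m : ann) : ann :=
  fun u => match t u with Some c => Some c | None => m u end.
Definition inst (t : ann) (C : list alit) : list alit :=
  map (fun l => match l with (x, b, s) => (x, b, restrictA x (compA s t)) end) C.
Definition disjA (s t : ann) : Prop := forall u, s u = None \/ t u = None.
Definition bin_range (t : ann) : Prop := forall u, t u <> Some TS.

(* the assignment falsifying the universal literals of a clause *)
Definition axiom_ann (F : QBF) (D : clause) : ann :=
  fun u => if quniv F u then
             if existsb (fun l => (fst l =? u) && snd l) D then Some T0
             else if existsb (fun l => (fst l =? u) && negb (snd l)) D then Some T1
             else None
           else None.

Definition irm_axiom_clause (F : QBF) (D : clause) : list alit :=
  map (fun l => (fst l, snd l, restrictA (fst l) (axiom_ann F D)))
      (filter (fun l => negb (quniv F (fst l))) D).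

Definition mergeA (m s : ann) : ann :=
  fun u => match m u, s u with
           | Some c, Some d =>
               if (match c, d with T0,T0 | T1,T1 | TS,TS => true | _,_ => false end)
               then Some c else Some TS
           | _, _ => None
           end.

Definition irm_step (F : QBF) (prev : list (list alit)) (C : list alit) : Prop :=
  (exists D, In D (qmat F) /\ aseteq C (irm_axiom_clause F D)) \/
  (exists P t, In P prev /\ bin_range t /\
     (forall u, t u <> None -> quniv F u = true) /\ aseteq C (inst t P)) \/
  (exists P1 P2 x t xi sg C1 C2, In P1 prev /\ In P2 prev /\
     disjA t xi /\ disjA t sg /\ disjA xi sg /\ bin_range t /\
     aseteq P1 ((x, true, compA t xi) :: C1) /\ ~ In (x, true, compA t xi) C1 /\
     aseteq P2 ((x, false, compA t sg) :: C2) /\ ~ In (x, false, compA t sg) C2 /\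
     aseteq C (inst sg C1 ++ inst xi C2)) \/
  (exists P x b m s D, In P prev /\
     (forall u, m u = None <-> s u = None) /\
     aseteq P ((x, b, m) :: (x, b, s) :: D) /\
     ~ In (x, b, m) D /\ ~ In (x, b, s) D /\
     aseteq C ((x, b, mergeA m s) :: D)).

Definition irm_refutation (F : QBF) (pi : list (list alit)) : Prop :=
  (forall i, i < length pi -> irm_step F (firstn i pi) (nth i pi [])) /\
  In [] pi.

(* variable numbering (order = prefix order):
     p_{uv}  (0 <= u < v < n)           : u*n + v               (< n*n)
     q_{iu}  (i < n/2, u < n)           : n*n + i*n + u         (< 2*n*n)
     r1_k    (k < m)                    : 2*n*n + k
     r2_g    (gate g)                   : 2*n*n + m + g
   prefix  : exists p exists q forall r1 exists r2 *)
Definition pv (n u v : nat) : nat := u * n + v.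
Definition qv (n i u : nat) : nat := n * n + i * n + u.
Definition b1 (n : nat) : nat := 2 * n * n.
Definition r1v (n k : nat) : nat := b1 n + k.
Definition r2v (n m g : nat) : nat := b1 n + m + g.

(* Boolean circuits whose wires are variable numbers: an input p_{uv} or
   r1_k, or the (Tseitin) variable r2_g of an earlier gate g. *)
Inductive gate := GAnd (a c : nat) | GOr (a c : nat) | GNot (a : nat).
Definition gate_wires (g : gate) : list nat :=
  match g with GAnd a c | GOr a c => [a; c] | GNot a => [a] end.

Definition circuit_wf (n m : nat) (gs : list gate) : Prop :=
  gs <> [] /\
  forall g, g < length gs -> forall w, In w (gate_wires (nth g gs (GNot 0))) ->
    (exists u v, u < v < n /\ w = pv n u v) \/
    (exists k, k < m /\ w = r1v n k) \/
    (exists g', g' < g /\ w = r2v n m g').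

Definition gate_val (val : nat -> bool) (g : gate) : bool :=
  match g with
  | GAnd a c => val a && val c
  | GOr a c => val a || val c
  | GNot a => negb (val a)
  end.

Definition circ_vals (n m : nat) (gs : list gate) (alpha : nat -> bool) : list bool :=
  fold_left (fun vals g =>
     vals ++ [gate_val (fun w => if w <? r2v n m 0 then alpha w
                                 else nth (w - r2v n m 0) vals false) g])
     gs [].
Definition circ_out (n m : nat) (gs : list gate) (alpha : nat -> bool) : bool :=
  last (circ_vals n m gs alpha) false.

Definition tseitin_gate (y : nat) (g : gate) : list clause :=
  match g with
  | GAnd a c => [[(y,false);(a,true)]; [(y,false);(c,true)]; [(y,true);(a,false);(c,false)]]
  | GOr a c => [[(y,true);(a,false)]; [(y,true);(c,false)]; [(y,false);(a,true);(c,true)]]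
  | GNot a => [[(y,true);(a,true)]; [(y,false);(a,false)]]
  end.
Definition B_cnf (n m : nat) (gs : list gate) : list clause :=
  flat_map (fun g => tseitin_gate (r2v n m g) (nth g gs (GNot 0))) (seq 0 (length gs))
  ++ [[(r2v n m (length gs - 1), true)]].

Definition A_cnf (n : nat) : list clause :=
  let h := n / 2 in
  map (fun i => map (fun u => (qv n i u, true)) (seq 0 n)) (seq 0 h)
  ++ flat_map (fun i => flat_map (fun j => if i <? j then
        map (fun u => [(qv n i u, false); (qv n j u, false)]) (seq 0 n) else [])
      (seq 0 h)) (seq 0 h)
  ++ flat_map (fun i => flat_map (fun u => flat_map (fun v => if u <? v then
        [[(qv n i u, false); (qv n i v, false)]] else [])
      (seq 0 n)) (seq 0 n)) (seq 0 h)
  ++ flat_map (fun i => flat_map (fun j => if negb (i =? j) then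
        flat_map (fun u => flat_map (fun v => if u <? v then
          [[(qv n i u, false); (qv n j v, false); (pv n u v, true)]] else [])
        (seq 0 n)) (seq 0 n) else [])
      (seq 0 h)) (seq 0 h).

Definition Phi (n m : nat) (gs : list gate) : QBF :=
  mkQBF (fun x => (b1 n <=? x) && (x <? b1 n + m)) (A_cnf n ++ B_cnf n m gs).

Definition has_clique (n k : nat) (a : nat -> nat -> bool) : Prop :=
  exists S : list nat, NoDup S /\ length S = k /\ (forall u, In u S -> u < n) /\
    (forall u v, In u S -> In v S -> u < v -> a u v = true).

(* Main.v *)
(* Feasible interpolation.  A refutation of [Phi n] is turned line by line into a
   monotone program over [p] with at most two gates per line.  On an assignment
   to [p] and [q] satisfying [A], a line with value 0 contains a true literal on
   [q] or a true positive literal on [p].  On a graph without a large clique, a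
   line with value 1 is true on the side of [B]: resolving over [q] chooses one
   premise (an or-gate), over [r] combines both (an and-gate), and over [p] lets
   the value of [p] choose.  At the empty clause the program accepts every clique
   and rejects every graph without one.
   Lower bound.  Each function of such a program is approximated by a disjunction
   of small cliques and a conjunction of edge sets of small rank.  Converting one
   form into the other, by branching on an unsatisfied term and cutting off terms
   that grow too large, misclassifies only an exponentially small fraction of the
   test cliques or of the test colourings, whereas the final function cannot be
   approximated well by either form. *)

(* A merged literal or an annotation with stars has no truth value under a single assignment. On the
   side of [B], truth therefore means that some data, chosen independently of [be], make the line
   true for every [be]: a causal choice of bits in LQU+-Res, a partial assignment in IRM-calc. For a
   pivot in [p] or [q] one premise suffices and its data are inherited; the work lies in combining
   the data of two premises at a later pivot. In the lower bound the two approximators are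
   controlled together: each clique of one must contain two vertices connected by each edge set of
   the other. A violated pair has few repairs, and each repair shrinks the set of satisfied tests by
   a fixed factor. The errors are small when this factor exceeds the number of repairs. Cliques on
   half of all vertices leave too little freedom for that, so the tests use about [s^2] groups of
   about [s^2] vertices, plus padding. Thus [n] of order [s^4] yields size [2^s]. *)
Require Import Defs.
From Stdlib Require Import List Arith Bool Lia Classical.
From mathcomp Require all_boot fingroup perm.
Import ListNotations.

(** * Monotone programs *)

(* Straight-line monotone programs over the variables [x < n * n]; only the
   conjunctions and disjunctions are counted. *)
Inductive mono_prog (n : nat) : nat -> list ((nat -> bool) -> bool) -> Prop :=
| mp_nil : mono_prog n 0 []
| mp_const b t gs : mono_prog n t gs -> mono_prog n t ((fun _ => b) :: gs)
| mp_var x t gs : x < n * n -> mono_prog n t gs ->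
    mono_prog n t ((fun al => al x) :: gs)
| mp_and g g' t gs : mono_prog n t gs -> In g gs -> In g' gs ->
    mono_prog n (S t) ((fun al => g al && g' al) :: gs)
| mp_or g g' t gs : mono_prog n t gs -> In g gs -> In g' gs ->
    mono_prog n (S t) ((fun al => g al || g' al) :: gs).

(** Graphs are given on all codes [x < n * n] of ordered pairs, since a program may read any of
    them; the edge variables of the formula are the codes with [x / n < x mod n]. *)
Definition clique_graph (n h : nat) (vert : nat -> nat) (x : nat) : bool :=
  negb (x / n =? x mod n) &&
  (existsb (fun i => vert i =? x / n) (seq 0 h) &&
   existsb (fun i => vert i =? x mod n) (seq 0 h)).

Definition colour_graph (n : nat) (phi : nat -> nat) (x : nat) : bool :=
  negb (phi (x / n) =? phi (x mod n)).

Lemma existsb_seq (p : nat -> bool) (h : nat) :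
  existsb p (seq 0 h) = true <-> exists i, i < h /\ p i = true.
Proof.
  rewrite existsb_exists; split; intros [i [Hi Hp]]; exists i; split; trivial;
    apply in_seq in Hi || apply in_seq; lia.
Qed.

Lemma clique_graph_true (n h : nat) (vert : nat -> nat) (x : nat) :
  clique_graph n h vert x = true ->
  x / n <> x mod n /\ (exists i, i < h /\ vert i = x / n) /\
  (exists j, j < h /\ vert j = x mod n).
Proof.
  unfold clique_graph; rewrite !andb_true_iff, negb_true_iff, !existsb_seq.
  intros [Hne [[i [Hi Ei]] [j [Hj Ej]]]].
  apply Nat.eqb_neq in Hne; apply Nat.eqb_eq in Ei, Ej; eauto 7.
Qed.

Lemma colour_graph_true (n : nat) (phi : nat -> nat) (x : nat) :
  phi (x / n) <> phi (x mod n) -> colour_graph n phi x = true.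
Proof. now intro H; apply negb_true_iff, Nat.eqb_neq. Qed.

(** * A lower bound for monotone clique programs *)

Module Counting.
Import all_boot fingroup perm.
Set Implicit Arguments.
Unset Strict Implicit.
Unset Printing Implicit Defensive.
Local Open Scope nat_scope.

(** Both thinness estimates have this form: a test for the stronger condition is modified in [#|W|]
    recoverable ways. *)
Lemma leq_card_times (X Y W : finType) (A : {set X}) (B : {set Y})
    (phi : X -> W -> Y) :
  (forall x w, x \in A -> phi x w \in B) ->
  (forall x x' w w', x \in A -> x' \in A -> phi x w = phi x' w' ->
     x = x' /\ w = w') ->
  #|A| * #|W| <= #|B|.
Proof.
move=> AB inj; rewrite -cardsT -cardsX.
rewrite -(card_in_imset (f := fun p => phi p.1 p.2)); last first.
  move=> [x w] [x' w'] /=; rewrite !inE /= !andbT => xA x'A e.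
  by case: (inj _ _ _ _ xA x'A e) => -> ->.
apply/subset_leq_card/subsetP => y /imsetP [[x w]]; rewrite !inE /= andbT => xA ->.
exact: AB.
Qed.

(** * Branching with states discarded above a rank *)

Section Branching.

(* Converting a conjunction of obstacles into a disjunction of states: a state
   that fails to hit some obstacle is replaced by at most [B] states of larger
   rank.  States of rank above [s] are discarded, and the tests they satisfy
   form the error set. *)
Variables (T : finType) (St O : eqType) (sat : St -> T -> bool) (rank : St -> nat).
Variables (hit : St -> O -> bool) (meets : O -> T -> bool) (W B s : nat).

Definition thin (x : St) := #|[set t | sat x t]| * W ^ rank x <= #|T|.

Variable Os : seq O.
Hypothesis branch : forall x o, thin x -> o \in Os -> ~~ hit x o ->
  exists L : seq St, [/\ size L <= B,
    forall y, y \in L -> rank x < rank y /\ thin y &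
    forall t, sat x t -> meets o t -> exists2 y, y \in L & sat y t].
Hypotheses (W_gt0 : 0 < W) (B_gt0 : 0 < B).

(** The rank grows along every edge of the branching tree, so the depth is at most [j] and at most
    [B ^ j] leaves are discarded. Such a leaf has rank above [s]; by thinness it satisfies at most a
    fraction [1 / W ^ s.+1] of the tests. *)
Lemma expand_from (j : nat) (x : St) :
  thin x -> s < rank x + j ->
  exists (D : seq St) (E : {set T}),
    [/\ forall y, y \in D -> rank y <= s,
        forall y o, y \in D -> o \in Os -> hit y o,
        #|E| * W ^ s.+1 <= B ^ j * #|T| &
        forall t, sat x t -> (forall o, o \in Os -> meets o t) -> t \notin E ->
          exists2 y, y \in D & sat y t].
Proof.
elim: j x => [|j IHj] x tx lt_s.
  exists [::], [set t | sat x t]; split => //.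
    rewrite expn0 mul1n; apply: leq_trans tx; rewrite leq_mul2l.
    by rewrite leq_pexp2l ?orbT // -(addn0 (rank x)).
  by move=> t st _; rewrite inE st.
case: (leqP (rank x) s) => [le_s|gt_s]; last first.
  exists [::], [set t | sat x t]; split => //.
    apply: (leq_trans (n := #|T|)); last by rewrite leq_pmull ?expn_gt0 ?B_gt0.
    by apply: leq_trans tx; rewrite leq_mul2l leq_pexp2l ?orbT.
  by move=> t st _; rewrite inE st.
case: (boolP (all (hit x) Os)) => [/allP allO|/allPn [o oO nhit]].
  exists [:: x], set0; split => //.
  - by move=> y; rewrite inE => /eqP ->.
  - by move=> y o; rewrite inE => /eqP ->; apply: allO.
  - by rewrite cards0.
  - by move=> t st _ _; exists x => //; rewrite inE.
have [L [szL rkL covL]] := branch tx oO nhit.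
suff [D [E [rkD hitD szE covD]]] : exists (D : seq St) (E : {set T}),
    [/\ forall y, y \in D -> rank y <= s,
        forall y o, y \in D -> o \in Os -> hit y o,
        #|E| * W ^ s.+1 <= size L * (B ^ j * #|T|) &
        forall z t, z \in L -> sat z t -> (forall o, o \in Os -> meets o t) ->
          t \notin E -> exists2 y, y \in D & sat y t].
  exists D, E; split => //.
    apply: leq_trans szE _; rewrite expnS -mulnA leq_mul2r szL orbT //.
  move=> t st mt tE; have [z zL zt] := covL _ st (mt _ oO).
  exact: covD zL zt mt tE.
elim: L rkL {covL szL} => [|z L IHL] rkL.
  by exists [::], set0; split => //; rewrite cards0.
have [|D1 [E1 [rk1 hit1 sz1 cov1]]] := IHL.
  by move=> y yL; apply: rkL; rewrite inE yL orbT.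
have [rkz tz] : rank x < rank z /\ thin z by apply: rkL; rewrite inE eqxx.
have [|D2 [E2 [rk2 hit2 sz2 cov2]]] := IHj z tz.
  by apply: leq_trans lt_s _; rewrite addnS -addSn leq_add2r.
exists (D1 ++ D2), (E1 :|: E2); split.
- by move=> y; rewrite mem_cat => /orP []; [apply: rk1 | apply: rk2].
- by move=> y o'; rewrite mem_cat => /orP []; [apply: hit1 | apply: hit2].
- rewrite /= mulSn addnC; apply: leq_trans (leq_add sz1 sz2).
  by rewrite -mulnDl leq_mul2r leq_card_setU orbT.
- move=> z' t zL zt mt; rewrite !inE negb_or => /andP [n1 n2].
  move: zL; rewrite inE => /orP [/eqP e|zL].
    have [|y yD yt] := cov2 t _ mt n2; first by rewrite -e.
    by exists y => //; rewrite mem_cat yD orbT.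
  have [y yD yt] := cov1 _ _ zL zt mt n1.
  by exists y => //; rewrite mem_cat yD.
Qed.

Lemma expand (x : St) :
  rank x = 0 -> (forall t, sat x t) ->
  exists (D : seq St) (E : {set T}),
    [/\ forall y, y \in D -> rank y <= s,
        forall y o, y \in D -> o \in Os -> hit y o,
        #|E| * W ^ s.+1 <= B ^ s.+1 * #|T| &
        forall t, (forall o, o \in Os -> meets o t) -> t \notin E ->
          exists2 y, y \in D & sat y t].
Proof.
move=> rx sx; have tx : thin x by rewrite /thin rx muln1 max_card.
have [|D [E [h1 h2 h3 h4]]] := @expand_from s.+1 x tx; first by rewrite rx.
by exists D, E; split => // t mt tE; apply: h4.
Qed.

End Branching.

(** * Tests and their approximation by cliques and edge sets *)

Section Tests.

Variables (k M q : nat).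
Hypotheses (M_gt0 : 0 < M) (q_gt1 : 1 < q).

(* A positive test picks one vertex in each of [k] groups of [M] vertices, and
   its graph is the clique on those vertices.  A negative test is a colouring
   with [q] colours, and its graph joins the vertices of different colours. *)
Local Notation V := ('I_k * 'I_M)%type.
Local Notation choice := {ffun 'I_k -> 'I_M}.
Local Notation colouring := {ffun V -> 'I_q}.

Definition chosen (f : choice) : {set V} := [set v | f v.1 == v.2].
Definition mono (F : seq (V * V)) (c : colouring) := all (fun e => c e.1 == c e.2) F.

(* The transitive closure of the edge set [F]. *)
Definition implied (F : seq (V * V)) (u v : V) :=
  [forall c, mono F c ==> (c u == c v)].
Definition cross (S : {set V}) (F : seq (V * V)) :=
  [exists u in S, exists v in S, (u != v) && implied F u v].
Definition clash (S : {set V}) (c : colouring) :=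
  [exists u in S, exists v in S, (u != v) && (c u == c v)].

(** Dropping the demand on [v] frees the choice in its group: a vertex of [S] in that group would
    have to be [v] itself. The overwritten value was [v.2], so the modification can be undone. *)
Lemma card_chosen_setU1 (S : {set V}) (v : V) : v \notin S ->
  #|[set f | v |: S \subset chosen f]| * M <= #|[set f | S \subset chosen f]|.
Proof.
move=> vS; rewrite -[X in _ * X]card_ord.
pose phi (f : choice) (d : 'I_M) : choice := [ffun i => if i == v.1 then d else f i].
apply: (leq_card_times (phi := phi)).
- move=> f d; rewrite !inE => /subsetP sub; apply/subsetP => u uS.
  have := sub u; rewrite !inE uS orbT => /(_ isT)/eqP fu.
  rewrite ffunE; case: (u.1 =P v.1) => [e|_]; last by rewrite fu.
  have := sub v; rewrite !inE eqxx => /(_ isT)/eqP fv.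
  by case/negP: vS; rewrite (_ : v = u) // [v]surjective_pairing [u]surjective_pairing -fv -e fu.
- move=> f f' d d'; rewrite !inE => /subsetP sub /subsetP sub' e.
  have := sub v; rewrite !inE eqxx => /(_ isT)/eqP fv.
  have := sub' v; rewrite !inE eqxx => /(_ isT)/eqP fv'.
  split; last by move/ffunP/(_ v.1): e; rewrite !ffunE eqxx.
  apply/ffunP => i; case: (eqVneq i v.1) => [->|ne]; first by rewrite fv fv'.
  by move/ffunP/(_ i): e; rewrite !ffunE (negbTE ne).
Qed.

Lemma thin_chosen (S : {set V}) :
  thin (fun (S : {set V}) (f : choice) => S \subset chosen f) (fun S : {set V} => #|S|) M S.
Proof.
rewrite /thin; move: {2}#|S| (erefl #|S|) => n.
elim: n S => [|n IHn] S cS; first by rewrite cS muln1 max_card.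
have /card_gt0P [v vS] : 0 < #|S| by rewrite cS.
have eS : S = v |: S :\ v by rewrite setD1K.
have cSv : #|S :\ v| = n by move: cS; rewrite (cardsD1 v) vS => -[].
have nv : v \notin S :\ v by rewrite !inE eqxx.
rewrite cS expnS mulnA; apply: leq_trans (IHn _ cSv); rewrite cSv.
by rewrite leq_mul2r; apply/orP; right; rewrite {1}eS; exact: card_chosen_setU1.
Qed.

(** A colouring [c0] constant along [F] with [c0 u != c0 v] yields a set [W] closed under the edges
    of [F], containing [u] but not [v]. Swapping the colour of [u] with [d] on [W] keeps [F]
    monochromatic. The untouched colour of [v], formerly also that of [u], and the new colour of [u]
    reveal the swap. *)
Lemma card_mono_cons (F : seq (V * V)) (u v : V) : ~~ implied F u v ->
  #|[set c | mono ((u, v) :: F) c]| * q <= #|[set c | mono F c]|.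
Proof.
case/forallPn => c0; rewrite negb_imply => /andP [m0 ne0].
rewrite -[X in _ * X]card_ord.
pose W := [set w | c0 w == c0 u].
have uW : u \in W by rewrite inE.
have vW : v \in W = false by rewrite inE eq_sym (negbTE ne0).
pose phi (c : colouring) (d : 'I_q) : colouring :=
  [ffun w => if w \in W then tperm (c u) d (c w) else c w].
apply: (leq_card_times (phi := phi)).
- move=> c d; rewrite !inE => /= /andP [_ /allP mc]; apply/allP => e eF.
  have /eqP ce := mc e eF; have /eqP c0e := (allP m0) e eF.
  by rewrite !ffunE !inE c0e ce.
- move=> c c' d d'; rewrite !inE => /= /andP [/eqP cuv _] /andP [/eqP cuv' _].
  move=> /ffunP e.
  have eu : c u = c' u by have := e v; rewrite !ffunE vW -cuv -cuv'.
  have ed : d = d' by have := e u; rewrite !ffunE uW !tpermL.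
  split=> //; apply/ffunP => w; have := e w; rewrite !ffunE.
  by case: ifP => // _; rewrite eu ed => /perm_inj.
Qed.

Definition ends (F : seq (V * V)) : seq V := [seq e.1 | e <- F] ++ [seq e.2 | e <- F].

Lemma implied_sym (F : seq (V * V)) (u v : V) : implied F u v = implied F v u.
Proof. by apply: eq_forallb => c; rewrite [c u == _]eq_sym. Qed.

(** A vertex on no edge of [F] can be given a colour of its own, for which two colours are needed.
    Hence only endpoints of [F] can be connected to another vertex, which keeps the number of
    branches independent of the size of the vertex set. *)
Lemma implied_ends (F : seq (V * V)) (u v : V) :
  u != v -> implied F u v -> u \in ends F.
Proof.
move=> ne /forallP imp; apply/negPn/negP => nu.
have q0 : 0 < q by apply: ltn_trans q_gt1.
pose c : colouring := [ffun w => if w == u then Ordinal q_gt1 else Ordinal q0].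
have := imp c; rewrite !ffunE eqxx [v == u]eq_sym (negbTE ne) implybF => /negP [].
apply/allP => e eF; rewrite !ffunE.
have /negbTE-> : e.1 != u.
  by apply: contraNneq nu => <-; rewrite mem_cat map_f.
by have /negbTE-> : e.2 != u
  by apply: contraNneq nu => <-; rewrite mem_cat map_f ?orbT.
Qed.

Lemma crossP (S : {set V}) (F : seq (V * V)) :
  reflect (exists u v, [/\ u \in S, v \in S, u != v & implied F u v]) (cross S F).
Proof.
apply: (iffP exists_inP) => [[u uS /exists_inP [v vS /andP [ne im]]]|].
  by exists u, v.
move=> [u [v [uS vS ne im]]]; exists u => //; apply/exists_inP; exists v => //.
by rewrite ne.
Qed.

Lemma clashP (S : {set V}) (c : colouring) :
  reflect (exists u v, [/\ u \in S, v \in S, u != v & c u = c v]) (clash S c).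
Proof.
apply: (iffP exists_inP) => [[u uS /exists_inP [v vS /andP [ne /eqP im]]]|].
  by exists u, v.
move=> [u [v [uS vS ne im]]]; exists u => //; apply/exists_inP; exists v => //.
by rewrite ne im eqxx.
Qed.

(** The two connected vertices of the clique are endpoints of the at most [r] edges of [F], which
    leaves [(2 * r) ^ 2] pairs. As [S] contains no such pair, adding one enlarges it. *)
Lemma branch_chosen (r : nat) (S : {set V}) (F : seq (V * V)) :
  size F <= r -> ~~ cross S F ->
  exists L : seq {set V}, [/\ size L <= (2 * r) ^ 2,
    forall S', S' \in L -> #|S| < #|S'| &
    forall f, S \subset chosen f -> cross (chosen f) F ->
      exists2 S', S' \in L & S' \subset chosen f].
Proof.
move=> szF ncr.
pose P := [seq p <- [seq (u, v) | u <- ends F, v <- ends F] |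
            (p.1 != p.2) && implied F p.1 p.2].
exists [seq p.1 |: (p.2 |: S) | p <- P]; split.
- rewrite size_map size_filter; apply: leq_trans (count_size _ _) _.
  rewrite size_allpairs size_cat !size_map addnn -mul2n.
  by rewrite leq_mul // leq_mul2l.
- move=> S' /mapP [p]; rewrite mem_filter => /andP [/andP [ne im] _ ->].
  apply: proper_card; rewrite properE; apply/andP; split.
    by apply/subsetP => w wS; rewrite !inE wS !orbT.
  apply: contra ncr => /subsetP sub; apply/crossP; exists p.1, p.2.
  by split => //; apply: sub; rewrite !inE eqxx ?orbT.
- move=> f Sf /crossP [u [v [uf vf ne im]]].
  exists (u |: (v |: S)); last by rewrite !subUset !sub1set uf vf.
  apply/mapP; exists (u, v) => //; rewrite mem_filter /= ne im /=.
  apply/allpairsP; exists (u, v); split => //=; first exact: implied_ends im.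
  by rewrite implied_sym in im; apply: implied_ends im; rewrite eq_sym.
Qed.

(** The dual step: the clash occurs on one of at most [s ^ 2] pairs in [S]. No such pair is implied
    by [F], so adding it as an edge divides the number of colourings by [q]. *)
Lemma branch_mono (s : nat) (F : seq (V * V)) (S : {set V}) :
  #|S| <= s -> thin mono size q F -> ~~ cross S F ->
  exists L : seq (seq (V * V)), [/\ size L <= s ^ 2,
    forall F', F' \in L -> size F < size F' /\ thin mono size q F' &
    forall c, mono F c -> clash S c -> exists2 F', F' \in L & mono F' c].
Proof.
move=> szS tF ncr.
pose P := [seq p <- [seq (u, v) | u <- enum S, v <- enum S] | p.1 != p.2].
exists [seq p :: F | p <- P]; split.
- rewrite size_map size_filter; apply: leq_trans (count_size _ _) _.
  by rewrite size_allpairs -cardE expnS expn1 leq_mul.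
- move=> F' /mapP [[u v]]; rewrite mem_filter => /andP [/= ne].
  case/allpairsP => -[u' v'] /= [uS vS [eu ev]] ->; split => //.
  rewrite mem_enum -eu in uS; rewrite mem_enum -ev in vS.
  rewrite /thin /= expnS mulnA; apply: leq_trans tF; rewrite leq_mul2r.
  apply/orP; right; apply: card_mono_cons; apply: contra ncr => im.
  by apply/crossP; exists u, v.
- move=> c mF /clashP [u [v [uS vS ne e]]].
  exists ((u, v) :: F); last by rewrite /= e eqxx.
  apply/mapP; exists (u, v) => //; rewrite mem_filter /= ne /=.
  by apply/allpairsP; exists (u, v); rewrite !mem_enum.
Qed.

Variables (s r : nat).
Hypotheses (s_gt1 : 1 < s) (r_gt0 : 0 < r).

(* [D] is a disjunction of cliques and [C] a conjunction of edge sets; the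
   function lies below [D] on the positive tests outside [Ep] and above [C] on
   the negative tests outside [En]. *)
Definition approx (Ep : {set choice}) (En : {set colouring})
    (gp : choice -> bool) (gn : colouring -> bool) : Prop :=
  exists (D : seq {set V}) (C : seq (seq (V * V))),
    [/\ forall S, S \in D -> #|S| <= s,
        forall F, F \in C -> size F <= r,
        forall S F, S \in D -> F \in C -> cross S F,
        forall f, f \notin Ep -> gp f -> exists2 S, S \in D & S \subset chosen f &
        forall c, c \notin En -> ~~ gn c -> exists2 F, F \in C & mono F c].

Lemma approx_weaken (Ep Ep' : {set choice}) (En En' : {set colouring}) gp gn :
  Ep \subset Ep' -> En \subset En' -> approx Ep En gp gn -> approx Ep' En' gp gn.
Proof.
move=> /subsetP sp /subsetP sn [D [C [h1 h2 h3 h4 h5]]].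
exists D, C; split => // x xn; [apply: h4 | apply: h5]; apply: contra xn.
  exact: sp.
exact: sn.
Qed.

Lemma approx_true Ep En gp : approx Ep En gp (fun => true).
Proof.
exists [:: set0], [::]; split => //.
  by move=> S; rewrite inE => /eqP ->; rewrite cards0.
by move=> f _ _; exists set0; rewrite ?inE ?sub0set.
Qed.

Lemma approx_false Ep En gn : approx Ep En (fun => false) gn.
Proof.
exists [::], [:: [::]]; split => //.
  by move=> F; rewrite inE => /eqP ->.
by move=> c _ _; exists [::]; rewrite ?inE.
Qed.

Lemma approx_edge Ep En (u v : V) : u != v ->
  approx Ep En (fun f => (u \in chosen f) && (v \in chosen f)) (fun c => c u != c v).
Proof.
move=> ne; exists [:: [set u; v]], [:: [:: (u, v)]]; split.
- by move=> S; rewrite inE => /eqP ->; rewrite cards2 ne.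
- by move=> F; rewrite inE => /eqP ->.
- move=> S F; rewrite !inE => /eqP -> /eqP ->; apply/crossP; exists u, v.
  rewrite !inE !eqxx orbT; split => //; apply/forallP => c; apply/implyP.
  by rewrite /mono /= andbT.
- move=> f _ /andP [uf vf]; exists [set u; v]; first by rewrite inE.
  by rewrite subUset !sub1set uf vf.
- move=> c _ /negPn e; exists [:: (u, v)]; first by rewrite inE.
  by rewrite /mono /= e.
Qed.

(** The edge sets are pooled without error and the cliques are regrown from the empty one. A choice
    accepted by both functions contains a clique from each old disjunction, so it crosses every
    pooled edge set and can be lost only through a discarded state. *)
Lemma approx_and Ep En gp gn gp' gn' :
  approx Ep En gp gn -> approx Ep En gp' gn' ->
  exists Ep' : {set choice}, #|Ep'| * M ^ s.+1 <= ((2 * r) ^ 2) ^ s.+1 * #|choice| /\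
    approx (Ep :|: Ep') En (fun f => gp f && gp' f) (fun c => gn c && gn' c).
Proof.
move=> [D1 [C1 [sD1 sC1 x1 p1 n1]]] [D2 [C2 [sD2 sC2 x2 p2 n2]]].
have sC F : F \in C1 ++ C2 -> size F <= r.
  by rewrite mem_cat => /orP []; [apply: sC1 | apply: sC2].
have B0 : 0 < (2 * r) ^ 2 by rewrite expn_gt0 muln_gt0 r_gt0.
have br (S : {set V}) (F : seq (V * V)) :
    thin (fun (S : {set V}) (f : choice) => S \subset chosen f)
      (fun S : {set V} => #|S|) M S ->
    F \in C1 ++ C2 -> ~~ cross S F ->
    exists L : seq {set V}, [/\ size L <= (2 * r) ^ 2,
      forall S', S' \in L -> #|S| < #|S'| /\
        thin (fun (S : {set V}) (f : choice) => S \subset chosen f)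
          (fun S : {set V} => #|S|) M S' &
      forall f, S \subset chosen f -> cross (chosen f) F ->
        exists2 S', S' \in L & S' \subset chosen f].
  move=> _ FC ncr; have [L [h1 h2 h3]] := branch_chosen (sC F FC) ncr.
  by exists L; split => // S' S'L; split; [exact: h2 | exact: thin_chosen].
have [D [E [rkD hitD szE covD]]] :=
  expand (meets := fun F f => cross (chosen f) F) s br M_gt0 B0 (cards0 V)
    (fun f => sub0set (chosen f)).
exists E; split => //; exists D, (C1 ++ C2); split => //.
- move=> f; rewrite !inE negb_or => /andP [fE fE'] /andP [g1 g2].
  apply: covD => // F FC.
  have sub (S : {set V}) : S \subset chosen f -> cross S F -> cross (chosen f) F.
    move=> /subsetP sS /crossP [u [v [uS vS ne im]]]; apply/crossP.
    by exists u, v; split => //; apply: sS.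
  move: FC; rewrite mem_cat => /orP [FC|FC].
    by have [S SD Sf] := p1 f fE g1; apply: (sub S) => //; apply: x1.
  by have [S SD Sf] := p2 f fE g2; apply: (sub S) => //; apply: x2.
- move=> c cE; rewrite negb_and => /orP [g|g].
    by have [F FC m] := n1 c cE g; exists F => //; rewrite mem_cat FC.
  by have [F FC m] := n2 c cE g; exists F => //; rewrite mem_cat FC orbT.
Qed.

Lemma clash_of_cross S F c : cross S F -> mono F c -> clash S c.
Proof.
move=> /crossP [u [v [uS vS ne /forallP /(_ c) im]]] mF; apply/clashP.
by exists u, v; split => //; apply/eqP; rewrite mF in im.
Qed.

(** Dually, the cliques are pooled and the edge sets are regrown from the empty one. A colouring
    rejected by both functions clashes on every pooled clique. *)
Lemma approx_or Ep En gp gn gp' gn' :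
  approx Ep En gp gn -> approx Ep En gp' gn' ->
  exists En' : {set colouring}, #|En'| * q ^ r.+1 <= (s ^ 2) ^ r.+1 * #|colouring| /\
    approx Ep (En :|: En') (fun f => gp f || gp' f) (fun c => gn c || gn' c).
Proof.
move=> [D1 [C1 [sD1 sC1 x1 p1 n1]]] [D2 [C2 [sD2 sC2 x2 p2 n2]]].
have sD S : S \in D1 ++ D2 -> #|S| <= s.
  by rewrite mem_cat => /orP []; [apply: sD1 | apply: sD2].
have B0 : 0 < s ^ 2 by rewrite expn_gt0 (ltn_trans _ s_gt1).
have q0 : 0 < q by apply: ltn_trans q_gt1.
have br (F : seq (V * V)) (S : {set V}) :
    thin mono size q F -> S \in D1 ++ D2 -> ~~ cross S F ->
    exists L : seq (seq (V * V)), [/\ size L <= s ^ 2,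
      forall F', F' \in L -> size F < size F' /\ thin mono size q F' &
      forall c, mono F c -> clash S c -> exists2 F', F' \in L & mono F' c].
  by move=> tF SD; apply: branch_mono => //; apply: sD.
have [C [E [rkC hitC szE covC]]] :=
  expand (x := [::]) (hit := fun F S => cross S F) r br q0 B0 (erefl 0)
    (fun c => isT).
exists E; split => //; exists (D1 ++ D2), C; split => //.
- by move=> S F SD FC; apply: hitC.
- move=> f fE /orP [g|g].
    by have [S SD m] := p1 f fE g; exists S => //; rewrite mem_cat SD.
  by have [S SD m] := p2 f fE g; exists S => //; rewrite mem_cat SD orbT.
- move=> c; rewrite !inE !negb_or => /andP [cE cE'] /andP [g1 g2].
  apply: covC => // S; rewrite mem_cat => /orP [SD|SD].
    by have [F FC m] := n1 c cE g1; apply: clash_of_cross m; apply: x1.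
  by have [F FC m] := n2 c cE g2; apply: clash_of_cross m; apply: x2.
Qed.

Lemma card_colouring_ffun : #|colouring| = q ^ (k * M).
Proof. by rewrite card_ffun !card_ord card_prod !card_ord. Qed.

(** A union bound over pairs: branching once from the empty edge list covers every clash by at most
    [s ^ 2] nonempty edge lists, each thin. *)
Lemma card_clash (S : {set V}) :
  #|S| <= s -> #|[set c | clash S c]| * q <= s ^ 2 * #|colouring|.
Proof.
move=> szS; case: (boolP (cross S [::])) => [/crossP [u [v [_ _ ne im]]]|ncr].
  by have := implied_ends ne im.
have t0 : thin mono size q [::] by rewrite /thin muln1 max_card.
have [L [szL rkL covL]] := branch_mono szS t0 ncr.
have q0 : 0 < q by apply: ltn_trans q_gt1.
apply: leq_trans (_ : size L * #|colouring| <= _); last by rewrite leq_mul2r szL orbT.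
pose A L' := [set c | has (fun F => mono F c) L'].
have sub : [set c | clash S c] \subset A L.
  apply/subsetP => c; rewrite !inE => cl; have [//|F FL mF] := covL c _ cl.
  by apply/hasP; exists F.
apply: (leq_trans (n := #|A L| * q)).
  by rewrite leq_mul2r (subset_leq_card sub) orbT.
elim: L {szL covL sub} rkL => [|F L IHL] rkL.
  by rewrite (_ : A [::] = set0) ?cards0 //; apply/setP => c; rewrite !inE.
rewrite /= mulSn.
apply: leq_trans (_ : (#|[set c | mono F c]| + #|A L|) * q <= _).
  rewrite (_ : A (F :: L) = [set c | mono F c] :|: A L).
    by rewrite leq_mul2r leq_card_setU orbT.
  by apply/setP => c; rewrite !inE.
rewrite mulnDl; apply: leq_add; last first.
  by apply: IHL => F' F'L; apply: rkL; rewrite inE F'L orbT.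
have [lt tF] := rkL F (mem_head _ _); apply: leq_trans tF.
by rewrite leq_mul2l (leq_trans _ (leq_pexp2l q0 lt)) ?expn1 ?orbT.
Qed.

(* A function that separates the tests has no approximation with few errors: a
   disjunct [S] accepts every colouring that is injective on [S]. *)
Lemma approx_separating (t : nat) (Ep : {set choice}) (En : {set colouring}) :
  2 * s ^ 2 <= q ->
  #|Ep| * M ^ s.+1 <= t * (((2 * r) ^ 2) ^ s.+1 * #|choice|) ->
  #|En| * q ^ r.+1 <= t * ((s ^ 2) ^ r.+1 * #|colouring|) ->
  approx Ep En (fun => true) (fun => false) ->
  M ^ s.+1 <= t * ((2 * r) ^ 2) ^ s.+1 \/ q ^ r.+1 <= 2 * t * (s ^ 2) ^ r.+1.
Proof.
move=> le_q szp szn [[|S D] [C [sD _ xDC pD nC]]].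
  left; have eE : Ep = setT.
    apply/setP => f; rewrite inE; apply/negPn/negP => fE.
    by have [] := pD f fE isT.
  have c0 : 0 < #|choice| by rewrite card_ffun !card_ord expn_gt0 M_gt0.
  by move: szp; rewrite eE cardsT mulnA mulnC leq_pmul2r.
right; have q0 : 0 < q by apply: ltn_trans q_gt1.
have c0 : 0 < #|colouring| by rewrite card_colouring_ffun expn_gt0 q0.
have szcl := card_clash (sD S (mem_head _ _)).
(* A colouring outside [En] is rejected, so some edge set of [C] is monochromatic under it; [S]
   crosses this set and therefore clashes. *)
have cov : setT \subset En :|: [set c | clash S c].
  apply/subsetP => c _; rewrite !inE; apply/norP => -[cE ncl].
  have [F FC mF] := nC c cE isT; case/negP: ncl; apply: clash_of_cross mF.
  by apply: xDC; rewrite ?mem_head.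
have tot : #|colouring| <= #|En| + #|[set c | clash S c]|.
  by rewrite -cardsT; apply: leq_trans (subset_leq_card cov) (leq_card_setU _ _).
(* Since [2 * s ^ 2 <= q], at most half of the colourings clash on [S], and [En] has to contain the
   other half. This is the origin of the factor 2 in the second alternative. *)
have half : #|colouring| <= 2 * #|En|.
  have : 2 * #|[set c | clash S c]| <= #|colouring|.
    rewrite -(leq_pmul2r q0) -mulnA.
    apply: leq_trans (_ : 2 * (s ^ 2 * #|colouring|) <= _); first by rewrite leq_mul2l.
    by rewrite mulnA [_ * q]mulnC leq_mul2r le_q orbT.
  move=> h; rewrite -(leq_add2r #|colouring|) addnn -mul2n.
  apply: leq_trans (_ : 2 * (#|En| + #|[set c | clash S c]|) <= _).
    by rewrite leq_mul2l tot.
  by rewrite mulnDr leq_add2l.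
rewrite -(leq_pmul2l c0).
apply: leq_trans (_ : 2 * (#|En| * q ^ r.+1) <= _).
  by rewrite mulnA leq_mul2r half orbT.
apply: leq_trans (_ : 2 * (t * ((s ^ 2) ^ r.+1 * #|colouring|)) <= _).
  by rewrite leq_mul2l szn.
by rewrite [X in _ <= X]mulnC !mulnA.
Qed.

End Tests.

(** * Embedding the tests into graphs on [n] vertices *)

Section CliquePrograms.

Variables (k M q n h : nat).
Hypotheses (M_gt0 : 0 < M) (q_gt1 : 1 < q) (k_def : k = q.+1) (k_le_h : k <= h).
Hypothesis (fits : k * M + (h - k) <= n).

Local Notation choice := {ffun 'I_k -> 'I_M}.
Local Notation colouring := {ffun 'I_k * 'I_M -> 'I_q}.

(* [h - k] padding vertices, adjacent to everything, raise the clique number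
   from [k] to [h]; the vertices after those are isolated in positive tests. *)
Definition clique_vertex (f : choice) (i : nat) : nat :=
  if insub i is Some j then (j : 'I_k) * M + f j else k * M + (i - k).

Definition vertex (u : nat) : option ('I_k * 'I_M) :=
  if insub (u %/ M) is Some i then
    if insub (u %% M) is Some j then Some (i, j) else None
  else None.

(** Private colours for the padding vertices bring the total to [q + (h - k) = h - 1], so no clique
    of size [h] exists. The remaining vertices occur in no test clique and may share colour 0. *)
Definition label (c : colouring) (u : nat) : nat :=
  if vertex u is Some w then c w
  else if u < k * M + (h - k) then q + (u - k * M) else 0.

Lemma ltn_vertex (i : 'I_k) (j : 'I_M) : i * M + j < k * M.
Proof.
apply: leq_trans (_ : i.+1 * M <= _); last by rewrite leq_mul2r ltn_ord orbT.
by rewrite mulSn addnC ltn_add2r.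
Qed.

Lemma vertexE (i : 'I_k) (j : 'I_M) : vertex (i * M + j) = Some (i, j).
Proof.
rewrite /vertex divnMDl // modnMDl divn_small // addn0 modn_small //.
by rewrite !valK.
Qed.

Lemma vertex_inv (u : nat) (w : 'I_k * 'I_M) : vertex u = Some w -> u = w.1 * M + w.2.
Proof.
rewrite /vertex; case: insubP => // i _ ei; case: insubP => // j _ ej [<-] /=.
by rewrite ei ej -divn_eq.
Qed.

Lemma vertex_None (u : nat) : vertex u = None -> k * M <= u.
Proof.
rewrite /vertex; case: insubP => [i _ _|].
  by case: insubP => // ; rewrite ltn_pmod.
by rewrite -leqNgt leq_divRL.
Qed.

Lemma clique_vertex_lt (f : choice) (i : nat) : i < h ->
  clique_vertex f i < k * M + (h - k).
Proof.
rewrite /clique_vertex => ih; case: insubP => [j _ _|].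
  by apply: leq_trans (ltn_vertex _ _) (leq_addr _ _).
by rewrite -leqNgt ltn_add2l => ki; apply: ltn_sub2r => //; apply: leq_ltn_trans ih.
Qed.

Lemma clique_vertex_inj (f : choice) (i j : nat) :
  clique_vertex f i = clique_vertex f j -> i = j.
Proof.
rewrite /clique_vertex; case: insubP => [i' _ <-|ni]; case: insubP => [j' _ <-|nj].
- move=> e; have := vertexE i' (f i'); rewrite e vertexE.
  by case=> -> _.
- by move=> e; have := ltn_vertex i' (f i'); rewrite e ltnNge leq_addr.
- by move=> e; have := ltn_vertex j' (f j'); rewrite -e ltnNge leq_addr.
- move/addnI => e; move: ni nj; rewrite -!leqNgt => ki kj.
  by rewrite -(subnK ki) e subnK.
Qed.

Lemma vertex_chosen (f : choice) (i : nat) (w : 'I_k * 'I_M) :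
  vertex (clique_vertex f i) = Some w -> w \in chosen f.
Proof.
rewrite /clique_vertex; case: insubP => [j _ _|_].
  by rewrite vertexE => -[<-]; rewrite inE.
move/vertex_inv => e; have := ltn_vertex w.1 w.2.
by rewrite -e ltnNge leq_addr.
Qed.

Lemma label_lt (c : colouring) (u : nat) : label c u < h.-1.
Proof.
have qh : q <= h.-1 by move: k_le_h; rewrite k_def; case: (h).
have q0 : 0 < q by apply: ltn_trans q_gt1.
rewrite /label; case E: (vertex u) => [w|]; first by apply: leq_trans (ltn_ord _) qh.
case: (ltnP u (k * M + (h - k))) => [lt|_]; last exact: leq_trans q0 qh.
have -> : h.-1 = q + (h - k) by rewrite -{1}(subnKC k_le_h) {1}k_def addSn.
by rewrite ltn_add2l ltn_subLR // vertex_None.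
Qed.

Let pos (f : choice) := clique_graph n h (clique_vertex f).
Let neg (c : colouring) := colour_graph n (label c).

Lemma approx_mono s r Ep En (gp gp' : choice -> bool) (gn gn' : colouring -> bool) :
  (forall f, gp' f -> gp f) -> (forall c, gn c -> gn' c) ->
  approx (k := k) (M := M) (q := q) s r Ep En gp gn -> approx s r Ep En gp' gn'.
Proof.
move=> hp hn [D [C [h1 h2 h3 h4 h5]]]; exists D, C; split => //.
  by move=> f fE /hp; apply: h4.
by move=> c cE ng; apply: h5 => //; apply: contra ng; apply: hn.
Qed.

Lemma label_neq (c : colouring) (u v : nat) : u <> v ->
  u < k * M + (h - k) -> v < k * M + (h - k) -> vertex u = None ->
  label c u != label c v.
Proof.
move=> ne ltu ltv eu; have leu := vertex_None eu.
rewrite /label eu ltu ltv; case ev: (vertex v) => [w|].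
  by rewrite gtn_eqF // ltn_addr.
have lev := vertex_None ev.
by rewrite eqn_add2l; apply/eqP => e; apply: ne; rewrite -(subnK leu) e subnK.
Qed.

(** Loops and pairs with a vertex beyond the padding are absent from every positive test, hence
    approximated by the constant 0. Other pairs with a padding vertex are present in every negative
    test, hence approximated by 1. What remains is an edge between two group vertices. *)
Lemma approx_var s r Ep En (x : nat) : 1 < s -> 0 < r ->
  approx s r Ep En (fun f => pos f x) (fun c => neg c x).
Proof.
move=> s1 r0; set u := Nat.div x n; set v := Nat.modulo x n.
have pos_clique f : pos f x -> [/\ u <> v, u < k * M + (h - k), v < k * M + (h - k) &
    (forall w, vertex u = Some w -> w \in chosen f) /\
    (forall w, vertex v = Some w -> w \in chosen f)].
  move=> /clique_graph_true [ne [[i [/ltP ih ei]] [j [/ltP jh ej]]]].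
  rewrite /u /v; split => //; rewrite -1?ei -1?ej ?clique_vertex_lt //.
  by split => w; apply: vertex_chosen.
have neg_label c : label c u != label c v -> neg c x.
  by move=> /eqP ne; apply: colour_graph_true.
have zero : (forall f, ~~ pos f x) ->
    approx s r Ep En (fun f => pos f x) (fun c => neg c x).
  move=> h0; apply: approx_mono (approx_false s r Ep En (fun c => neg c x)) => //.
  by move=> f; rewrite (negbTE (h0 f)).
have one : (forall c, label c u != label c v) ->
    approx s r Ep En (fun f => pos f x) (fun c => neg c x).
  move=> h1; apply: approx_mono (approx_true s r Ep En (fun f => pos f x)) => //.
  by move=> c _; apply: neg_label.
case: (u =P v) => [e|ne]; first by apply: zero => f; apply/negP => /pos_clique [].
case: (leqP (k * M + (h - k)) u) => [gu|ltu].
  by apply: zero => f; apply/negP => /pos_clique [_]; rewrite ltnNge gu.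
case: (leqP (k * M + (h - k)) v) => [gv|ltv].
  by apply: zero => f; apply/negP => /pos_clique [_ _]; rewrite ltnNge gv.
case eu: (vertex u) => [w|]; last by apply: one => c; apply: label_neq.
case ev: (vertex v) => [w'|]; last first.
  by apply: one => c; rewrite eq_sym; apply: label_neq => //; apply: nesym.
have nw : w != w'.
  by apply/eqP => e; apply: ne; rewrite (vertex_inv eu) e -(vertex_inv ev).
apply: approx_mono (approx_edge s1 r0 Ep En nw).
  by move=> f /pos_clique [_ _ _ [hu hv]]; rewrite hu ?hv.
by move=> c ne'; apply: neg_label; rewrite /label eu ev.
Qed.

Lemma approx_prog s r t gs : 1 < s -> 0 < r -> mono_prog n t gs ->
  exists (Ep : {set choice}) (En : {set colouring}),
    [/\ #|Ep| * M ^ s.+1 <= t * (((2 * r) ^ 2) ^ s.+1 * #|choice|),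
        #|En| * q ^ r.+1 <= t * ((s ^ 2) ^ r.+1 * #|colouring|) &
        forall g, In g gs -> approx s r Ep En (g \o pos) (g \o neg)].
Proof.
move=> s1 r0; elim=> {t gs} [|b t gs _ [Ep [En [p1 p2 p3]]]|x t gs _ _ [Ep [En [p1 p2 p3]]]|
  g g' t gs _ [Ep [En [p1 p2 p3]]] gi g'i|g g' t gs _ [Ep [En [p1 p2 p3]]] gi g'i].
- by exists set0, set0; rewrite !cards0.
- exists Ep, En; split => // g0 [<-|]; last exact: p3.
  by case: b; [apply: approx_true | apply: approx_false].
- by exists Ep, En; split => // g0 [<-|]; [apply: approx_var | apply: p3].
- have [E [szE ap]] := approx_and M_gt0 q_gt1 r0 (p3 g gi) (p3 g' g'i).
  exists (Ep :|: E), En; split.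
  + rewrite mulSn addnC; apply: leq_trans (leq_add p1 szE).
    by rewrite -mulnDl leq_mul2r leq_card_setU orbT.
  + by apply: leq_trans p2 _; rewrite leq_mul2r leqnSn orbT.
  + move=> g0 [<- //|gi']; apply: approx_weaken (p3 _ gi') => //.
    exact: subsetUl.
- have [E [szE ap]] := approx_or q_gt1 s1 (p3 g gi) (p3 g' g'i).
  exists Ep, (En :|: E); split.
  + by apply: leq_trans p1 _; rewrite leq_mul2r leqnSn orbT.
  + rewrite mulSn addnC; apply: leq_trans (leq_add p2 szE).
    by rewrite -mulnDl leq_mul2r leq_card_setU orbT.
  + move=> g0 [<- //|gi']; apply: approx_weaken (p3 _ gi') => //.
    exact: subsetUl.
Qed.

Lemma prog_separating s r t gs g : 1 < s -> 0 < r -> 2 * s ^ 2 <= q ->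
  mono_prog n t gs -> In g gs ->
  (forall vert, (forall i, i < h -> vert i < n) ->
     (forall i j, vert i = vert j -> i = j) -> g (clique_graph n h vert) = true) ->
  (forall phi, (forall u, phi u < h.-1) -> g (colour_graph n phi) = false) ->
  M ^ s.+1 <= t * ((2 * r) ^ 2) ^ s.+1 \/ q ^ r.+1 <= 2 * t * (s ^ 2) ^ r.+1.
Proof.
move=> s1 r0 le_q mp gi gp gn.
have [Ep [En [p1 p2 p3]]] := approx_prog s1 r0 mp.
apply: (approx_separating M_gt0 q_gt1 le_q p1 p2).
apply: approx_mono (p3 g gi) => [f _|c] /=.
  apply: gp => [i ih|i j]; last exact: clique_vertex_inj.
  by apply: leq_trans fits; apply: clique_vertex_lt.
by rewrite gn // => u; apply: label_lt.
Qed.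
End CliquePrograms.

Lemma ltn_expn_factor (a t s : nat) : 0 < a ->
  (2 * a) ^ s <= t * a ^ s -> 2 ^ s <= t.
Proof. by move=> a0; rewrite expnMn leq_pmul2r // expn_gt0 a0. Qed.

Lemma prog_lower_bound (n h s t : nat) gs g : 1 < s ->
  (2 * s ^ 2).+1 * (2 * (2 * s) ^ 2) <= h -> 2 * h <= n ->
  mono_prog n t gs -> In g gs ->
  (forall vert, (forall i, i < h -> vert i < n) ->
     (forall i j, vert i = vert j -> i = j) -> g (clique_graph n h vert) = true) ->
  (forall phi, (forall u, phi u < h.-1) -> g (colour_graph n phi) = false) ->
  2 ^ s <= t.
Proof.
move=> s1 le_h le_n mp gi gp gn.
have s0 : 0 < s by apply: ltn_trans s1.
(* With [r = s], the factors [q] and [M] are twice the branching numbers [s ^ 2] and [(2 * s) ^ 2],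
   so each gate adds an error fraction of at most [1 / 2 ^ s.+1]. *)
set q := 2 * s ^ 2; set M := 2 * (2 * s) ^ 2.
have M0 : 0 < M by rewrite muln_gt0 expn_gt0 muln_gt0 s0.
have q1 : 1 < q by rewrite -[1]/(1 * 1)%N /q -{1}(muln1 2) leq_mul // expn_gt0 s0.
have kh : q.+1 <= h by apply: leq_trans le_h; rewrite leq_pmulr.
have fits : q.+1 * M + (h - q.+1) <= n.
  by apply: leq_trans le_n; rewrite mul2n -addnn leq_add // leq_subr.
case: (prog_separating M0 q1 (erefl _) kh fits s1 s0 (leqnn _) mp gi gp gn) => le.
  apply: leq_trans (_ : 2 ^ s.+1 <= _); first by rewrite leq_pexp2l.
  by apply: ltn_expn_factor le; rewrite expn_gt0 muln_gt0 s0.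
rewrite -(leq_pmul2l (isT : 0 < 2)) -expnS.
by apply: ltn_expn_factor le; rewrite expn_gt0 s0.
Qed.

Lemma expn_pow (a b : nat) : a ^ b = Nat.pow a b.
Proof. by elim: b => // b IHb; rewrite expnS IHb. Qed.

End Counting.

(** The factors [2 * (s * s) + 1] and [8 * (s * s)] are the number of groups and their size; half of
    the vertices hold the groups, the other half leaves room for the padding. *)
Theorem mono_clique_lower_bound (n h s t : nat) gs g :
  2 <= s -> (2 * (s * s) + 1) * (8 * (s * s)) <= h -> 2 * h <= n ->
  mono_prog n t gs -> In g gs ->
  (forall vert, (forall i, i < h -> vert i < n) ->
     (forall i j, vert i = vert j -> i = j) -> g (clique_graph n h vert) = true) ->
  (forall phi, (forall u, phi u < h - 1) -> g (colour_graph n phi) = false) ->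
  2 ^ s <= t.
Proof.
  intros Hs Hh Hn Hmp Hg Hp Hc.
  rewrite <- Counting.expn_pow.
  apply (Bool.reflect_iff _ _ ssrnat.leP).
  apply (@Counting.prog_lower_bound n h s t gs g); trivial.
  - now apply (Bool.reflect_iff _ _ ssrnat.leP).
  - apply (Bool.reflect_iff _ _ ssrnat.leP); rewrite !Counting.expn_pow.
    change ssrnat.muln with Nat.mul; rewrite !Nat.pow_2_r.
    refine (Nat.le_trans _ _ _ (Nat.eq_le_incl _ _ _) Hh); ring.
  - now apply (Bool.reflect_iff _ _ ssrnat.leP).
  - intros vert Hlt; apply Hp; intros i Hi.
    now apply (Bool.reflect_iff _ _ ssrnat.leP), Hlt, (Bool.reflect_iff _ _ ssrnat.leP).
  - intros phi Hlt; apply Hc; intros u; specialize (Hlt u).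
    apply (Bool.reflect_iff _ _ ssrnat.leP) in Hlt; lia.
Qed.

(** * Interpolation *)

Lemma firstn_S_nth {A : Type} (l : list A) (d : A) (k : nat) : k < length l ->
  firstn (S k) l = firstn k l ++ [nth k l d].
Proof.
  revert k; induction l as [|y l IH]; simpl; [lia|].
  intros [|k] Hk; [reflexivity|].
  simpl; f_equal; apply (IH k); lia.
Qed.

Section ProofsToPrograms.

Variables (L : Type) (n : nat) (step : list L -> L -> Prop).
Variable inv : ((nat -> bool) -> bool) -> L -> Prop.

(** [gate_sel] serves a pivot [x] in [p], positive in [P1]. It replaces the non-monotone selection
    of [g2] if [al x] and [g1] otherwise; the two differ only if [al x] and [g2] are 0 and [g1] is
    1. The value 0 is still right there, because a negative literal on [p] never makes a line true
    on the side of [A]. *)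
Inductive gate_from (prev : list L) (C : L) : Prop :=
| gate_const b : inv (fun _ => b) C -> gate_from prev C
| gate_copy P : In P prev -> (forall g, inv g P -> inv g C) -> gate_from prev C
| gate_and P1 P2 : In P1 prev -> In P2 prev ->
    (forall g1 g2, inv g1 P1 -> inv g2 P2 -> inv (fun al => g1 al && g2 al) C) ->
    gate_from prev C
| gate_or P1 P2 : In P1 prev -> In P2 prev ->
    (forall g1 g2, inv g1 P1 -> inv g2 P2 -> inv (fun al => g1 al || g2 al) C) ->
    gate_from prev C
| gate_sel P1 P2 x : In P1 prev -> In P2 prev -> x < n * n ->
    (forall g1 g2, inv g1 P1 -> inv g2 P2 ->
       inv (fun al => g2 al && (al x || g1 al)) C) -> gate_from prev C.

Hypothesis step_gate : forall prev C, step prev C -> gate_from prev C.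

Lemma program_step (prev : list L) (C : L) t gs :
  step prev C -> mono_prog n t gs ->
  (forall P, In P prev -> exists g, In g gs /\ inv g P) ->
  exists t' gs', t' <= t + 2 /\ mono_prog n t' gs' /\ incl gs gs' /\
    exists g, In g gs' /\ inv g C.
Proof.
  intros Hs Hm Hinv.
  destruct (step_gate _ _ Hs) as [b HC|P HP HC|P1 P2 HP1 HP2 HC|P1 P2 HP1 HP2 HC
    |P1 P2 x HP1 HP2 Hx HC];
    try (destruct (Hinv P1 HP1) as [g1 [G1 I1]]; destruct (Hinv P2 HP2) as [g2 [G2 I2]]).
  - exists t; eexists; split; [lia|split; [apply (mp_const _ b _ _ Hm)|split]].
    + apply incl_tl, incl_refl.
    + eexists; split; [left; reflexivity|exact HC].
  - destruct (Hinv P HP) as [g [G I]].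
    exists t, gs; split; [lia|split; [trivial|split; [apply incl_refl|]]].
    exists g; auto.
  - exists (S t); eexists; split; [lia|split; [apply (mp_and _ _ _ _ _ Hm G1 G2)|split]].
    + apply incl_tl, incl_refl.
    + eexists; split; [left; reflexivity|auto].
  - exists (S t); eexists; split; [lia|split; [apply (mp_or _ _ _ _ _ Hm G1 G2)|split]].
    + apply incl_tl, incl_refl.
    + eexists; split; [left; reflexivity|auto].
  - pose proof (mp_var _ _ _ _ Hx Hm) as Hv.
    pose proof (mp_or _ _ _ _ _ Hv (or_introl eq_refl) (or_intror G1)) as Ho.
    pose proof (mp_and _ g2 _ _ _ Ho (or_intror (or_intror G2)) (or_introl eq_refl)) as Ha.
    exists (S (S t)); eexists; split; [lia|split; [exact Ha|split]].
    + do 3 apply incl_tl; apply incl_refl.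
    + eexists; split; [left; reflexivity|exact (HC _ _ I1 I2)].
Qed.

Lemma program_of_proof (d : L) (pi : list L) :
  (forall i, i < length pi -> step (firstn i pi) (nth i pi d)) ->
  exists t gs, t <= 2 * length pi /\ mono_prog n t gs /\
    forall C, In C pi -> exists g, In g gs /\ inv g C.
Proof.
  intros Hpi.
  enough (H : forall k, k <= length pi -> exists t gs, t <= 2 * k /\ mono_prog n t gs /\
    forall C, In C (firstn k pi) -> exists g, In g gs /\ inv g C).
  { destruct (H (length pi) (le_n _)) as [t [gs H']]; rewrite firstn_all in H'; eauto. }
  induction k as [|k IHk]; intros Hk.
  - exists 0, []; split; [lia|split; [constructor|intros C []]].
  - destruct IHk as [t [gs [Ht [Hm HC]]]]; [lia|].
    destruct (program_step _ _ _ _ (Hpi k Hk) Hm HC) as [t' [gs' [Ht' [Hm' [Hi Hg]]]]].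
    exists t', gs'; split; [lia|split; [trivial|]].
    intros C HCin.
    rewrite (firstn_S_nth _ d) in HCin by exact Hk; apply in_app_or in HCin; destruct HCin as [HCin|[<-|[]]]; trivial.
    destruct (HC C HCin) as [g [Hg1 Hg2]]; exists g; auto.
Qed.

End ProofsToPrograms.

(** The interpolant reads only [p], so a clique graph may be completed by values for [q] before its
    value is determined. *)
Lemma mono_prog_ext (n t : nat) gs : mono_prog n t gs -> forall g, In g gs ->
  forall al al', (forall x, x < n * n -> al x = al' x) -> g al = g al'.
Proof.
  induction 1 as [|b t gs _ IH|x t gs Hx _ IH|g1 g2 t gs _ IH G1 G2|g1 g2 t gs _ IH G1 G2];
    intros g Hg al al' E; [destruct Hg|..]; destruct Hg as [<-|Hg]; eauto;
    rewrite (IH _ G1 _ _ E), (IH _ G2 _ _ E); reflexivity.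
Qed.

(** * Truth of the clauses of [A] and [B] *)

Section Formula.

Variables (n m : nat) (gl : list gate).
Hypothesis wf : circuit_wf n m gl.

Definition is_q (x : nat) : Prop := n * n <= x < b1 n.
Definition is_r1 (x : nat) : Prop := b1 n <= x < b1 n + m.

Lemma quniv_r1 (x : nat) : quniv (Phi n m gl) x = true <-> is_r1 x.
Proof. simpl; rewrite andb_true_iff, Nat.leb_le, Nat.ltb_lt; reflexivity. Qed.

Lemma quniv_r1_false (x : nat) : quniv (Phi n m gl) x = false <-> ~ is_r1 x.
Proof. rewrite <- quniv_r1; destruct (quniv _ x); split; congruence. Qed.

Definition merge_pr (al be : nat -> bool) (x : nat) : bool :=
  if x <? b1 n then al x else be x.

(* The assignment in which the gate variables are evaluated from [p] and [r1]. *)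
Definition eval_all (al be : nat -> bool) (x : nat) : bool :=
  if x <? r2v n m 0 then merge_pr al be x
  else nth (x - r2v n m 0) (circ_vals n m gl (merge_pr al be)) false.

Definition accepts (al : nat -> bool) : Prop :=
  forall be, circ_out n m gl (merge_pr al be) = true.

Lemma eval_all_p (al be : nat -> bool) (x : nat) : x < b1 n -> eval_all al be x = al x.
Proof.
  intros H; unfold eval_all, merge_pr, r2v.
  now rewrite (proj2 (Nat.ltb_lt _ _)), (proj2 (Nat.ltb_lt _ _)) by lia.
Qed.

Lemma eval_all_r1 (al be : nat -> bool) (x : nat) : is_r1 x -> eval_all al be x = be x.
Proof.
  intros [H1 H2]; unfold eval_all, merge_pr, r2v.
  now rewrite (proj2 (Nat.ltb_lt _ (_ + _ + _))), (proj2 (Nat.ltb_ge _ _)) by lia.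
Qed.

Definition gate_env (vals : list bool) (f : nat -> bool) (w : nat) : bool :=
  if w <? r2v n m 0 then f w else nth (w - r2v n m 0) vals false.

Lemma gate_val_ext (f f' : nat -> bool) (g : gate) :
  (forall w, In w (gate_wires g) -> f w = f' w) -> gate_val f g = gate_val f' g.
Proof. destruct g; simpl; intros H; rewrite ?H; auto; rewrite H; auto. Qed.

Lemma circ_vals_snoc (gs : list gate) (g : gate) (f : nat -> bool) :
  circ_vals n m (gs ++ [g]) f =
  circ_vals n m gs f ++ [gate_val (gate_env (circ_vals n m gs f) f) g].
Proof. unfold circ_vals; rewrite fold_left_app; reflexivity. Qed.

Lemma circ_vals_length (gs : list gate) (f : nat -> bool) :
  length (circ_vals n m gs f) = length gs.
Proof.
  induction gs as [|g gs IH] using rev_ind; [reflexivity|].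
  rewrite circ_vals_snoc, !length_app, IH; reflexivity.
Qed.

Lemma circ_vals_ext (gs : list gate) (f f' : nat -> bool) :
  (forall w, w < r2v n m 0 -> f w = f' w) -> circ_vals n m gs f = circ_vals n m gs f'.
Proof.
  intros E; induction gs as [|g gs IH] using rev_ind; [reflexivity|].
  rewrite !circ_vals_snoc, IH; f_equal; f_equal.
  apply gate_val_ext; intros w _; unfold gate_env.
  destruct (Nat.ltb_spec w (r2v n m 0)); auto.
Qed.

Lemma eval_all_ext (al be be' : nat -> bool) (x : nat) :
  (forall u, is_r1 u -> be u = be' u) -> eval_all al be x = eval_all al be' x.
Proof.
  intros E.
  assert (Em : forall w, w < r2v n m 0 -> merge_pr al be w = merge_pr al be' w).
  { intros w Hw; unfold merge_pr; destruct (Nat.ltb_spec w (b1 n)); trivial.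
    apply E; unfold is_r1, r2v in *; lia. }
  unfold eval_all; destruct (Nat.ltb_spec x (r2v n m 0)); auto.
  now rewrite (circ_vals_ext _ _ _ Em).
Qed.

(** Later gates only append values and wires lead to earlier gates, so evaluating gate [g] against
    the full list gives what it gave when it was added. *)
Lemma circ_vals_nth (gs : list gate) (f : nat -> bool) (d : gate) (g : nat) :
  (forall w, In w (gate_wires (nth g gs d)) ->
     w < r2v n m 0 \/ exists g', g' < g /\ w = r2v n m g') ->
  g < length gs ->
  nth g (circ_vals n m gs f) false =
  gate_val (gate_env (circ_vals n m gs f) f) (nth g gs d).
Proof.
  induction gs as [|g0 gs IH] using rev_ind; simpl length; [lia|].
  rewrite length_app; simpl; intros Hw Hg.
  assert (Henv : forall w, In w (gate_wires (nth g (gs ++ [g0]) d)) ->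
    gate_env (circ_vals n m gs f) f w = gate_env (circ_vals n m (gs ++ [g0]) f) f w).
  { intros w Hin; unfold gate_env; destruct (Nat.ltb_spec w (r2v n m 0)); trivial.
    destruct (Hw w Hin) as [?|[g' [Hg' ->]]]; [lia|].
    rewrite circ_vals_snoc, app_nth1; trivial.
    rewrite circ_vals_length; unfold r2v; lia. }
  rewrite <- (gate_val_ext _ _ _ Henv), circ_vals_snoc.
  destruct (Nat.eq_dec g (length gs)) as [->|Hne].
  - rewrite nth_middle, app_nth2; rewrite circ_vals_length; [|lia].
    now rewrite Nat.sub_diag.
  - rewrite (app_nth1 gs) in * by lia.
    rewrite app_nth1 by (rewrite circ_vals_length; lia).
    apply IH; trivial; lia.
Qed.

Lemma eval_all_gate (al be : nat -> bool) (g : nat) : g < length gl ->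
  eval_all al be (r2v n m g) = gate_val (eval_all al be) (nth g gl (GNot 0)).
Proof.
  intros Hg; unfold eval_all at 1.
  rewrite (proj2 (Nat.ltb_ge _ _)) by (unfold r2v; lia).
  replace (r2v n m g - r2v n m 0) with g by (unfold r2v; lia).
  apply circ_vals_nth; trivial.
  intros w Hw; destruct (proj2 wf g Hg w Hw) as [[u [v [H ->]]]|[[k [H ->]]|H]]; auto;
    left; unfold r2v, r1v, b1, pv; nia.
Qed.

Lemma eval_all_out (al be : nat -> bool) : accepts al ->
  eval_all al be (r2v n m (length gl - 1)) = true.
Proof.
  intros Ha; rewrite <- (Ha be); unfold eval_all, circ_out.
  rewrite (proj2 (Nat.ltb_ge _ _)) by (unfold r2v; lia).
  replace (r2v n m (length gl - 1) - r2v n m 0) with (length gl - 1) by (unfold r2v; lia).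
  rewrite <- (circ_vals_length gl (merge_pr al be)).
  set (l := circ_vals n m gl (merge_pr al be)); clearbody l.
  induction l as [|y l IH]; [reflexivity|].
  destruct l as [|z l]; [reflexivity|].
  simpl in *; rewrite <- IH; now rewrite Nat.sub_0_r.
Qed.

Lemma tseitin_sat (val : nat -> bool) (y : nat) (g : gate) (D : clause) :
  val y = gate_val val g -> In D (tseitin_gate y g) ->
  exists l, In l D /\ val (fst l) = snd l.
Proof.
  destruct g as [a c|a c|a]; simpl; intros E HD;
    destruct (val a) eqn:Ea; try destruct (val c) eqn:Ec; simpl in E;
    repeat destruct HD as [<-|HD]; try contradiction HD;
    solve [ eexists; split; [left; reflexivity|assumption]
          | eexists; split; [right; left; reflexivity|assumption]
          | eexists; split; [right; right; left; reflexivity|assumption] ].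
Qed.

Lemma B_sat (al be : nat -> bool) (D : clause) : accepts al -> In D (B_cnf n m gl) ->
  exists l, In l D /\ eval_all al be (fst l) = snd l.
Proof.
  intros Ha HD; apply in_app_or in HD; destruct HD as [HD|[<-|[]]].
  - apply in_flat_map in HD; destruct HD as [g [Hg HD]]; apply in_seq in Hg.
    apply (tseitin_sat _ _ _ _ (eval_all_gate al be g ltac:(lia)) HD).
  - eexists; split; [left; reflexivity|]; apply eval_all_out, Ha.
Qed.

Lemma tseitin_lits (y : nat) (g : gate) (D : clause) (l : lit) :
  In D (tseitin_gate y g) -> In l D -> fst l = y \/ In (fst l) (gate_wires g).
Proof.
  destruct g; simpl; intros HD Hl;
    repeat destruct HD as [<-|HD]; try contradiction HD;
    repeat destruct Hl as [<-|Hl]; try contradiction Hl; simpl; auto.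
Qed.

Lemma tseitin_sign (y : nat) (g : gate) (D : clause) (l l' : lit) :
  In D (tseitin_gate y g) -> In l D -> In l' D -> fst l <> y -> fst l = fst l' -> l = l'.
Proof.
  destruct g; simpl; intros HD Hl Hl' Hne He;
    repeat destruct HD as [<-|HD]; try contradiction HD;
    repeat destruct Hl as [<-|Hl]; try contradiction Hl; simpl in *;
    repeat destruct Hl' as [<-|Hl']; try contradiction Hl'; simpl in *; congruence.
Qed.

Lemma B_lits (D : clause) (l : lit) : In D (B_cnf n m gl) -> In l D -> ~ is_q (fst l).
Proof.
  intros HD Hl; apply in_app_or in HD; destruct HD as [HD|[<-|[]]].
  - apply in_flat_map in HD; destruct HD as [g [Hg HD]]; apply in_seq in Hg.
    destruct (tseitin_lits _ _ _ _ HD Hl) as [->|Hw].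
    + unfold is_q, r2v; lia.
    + destruct (proj2 wf g ltac:(lia) _ Hw) as [[u [v [H ->]]]|[[k [H ->]]|[g' [H ->]]]];
        unfold is_q, r2v, r1v, b1, pv; nia.
  - destruct Hl as [<-|[]]; simpl; unfold is_q, r2v; lia.
Qed.

(** Within one gate clause all inputs have the same polarity, even if they coincide. Hence the
    universal literals of an axiom can be falsified simultaneously. *)
Lemma B_sign (D : clause) (l l' : lit) : In D (B_cnf n m gl) -> In l D -> In l' D ->
  is_r1 (fst l) -> fst l = fst l' -> l = l'.
Proof.
  intros HD Hl Hl' Hr He; apply in_app_or in HD; destruct HD as [HD|[<-|[]]].
  - apply in_flat_map in HD; destruct HD as [g [_ HD]].
    apply (tseitin_sign _ _ _ _ _ HD Hl Hl'); trivial.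
    unfold is_r1, r2v in *; lia.
  - destruct Hl as [<-|[]]; destruct Hl' as [<-|[]]; reflexivity.
Qed.

(* The variables [p] occur only positively in [A], so negative literals on them
   may be ignored on the side of [A]; this is what makes the interpolant monotone. *)
Definition true_A (tau : nat -> bool) (x : nat) (b : bool) : Prop :=
  x < b1 n /\ tau x = b /\ (x < n * n -> b = true).

Definition satisfies_A (tau : nat -> bool) : Prop :=
  forall D, In D (A_cnf n) -> exists l, In l D /\ tau (fst l) = snd l.

Lemma A_lits (D : clause) (l : lit) : In D (A_cnf n) -> In l D ->
  fst l < b1 n /\ (fst l < n * n -> snd l = true).
Proof.
  assert (Hq : forall i u, i < n / 2 -> u < n -> n * n <= qv n i u < b1 n).
  { intros i u Hi Hu; unfold qv, b1.
    assert (n / 2 <= n) by (apply Nat.Div0.div_le_upper_bound; lia); nia. }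
  assert (Hp : forall u v, u < n -> v < n -> pv n u v < n * n)
    by (intros; unfold pv; nia).
  unfold A_cnf; rewrite !in_app_iff; intros [H|[H|[H|H]]] Hl.
  - apply in_map_iff in H; destruct H as [i [<- Hi]]; apply in_seq in Hi.
    apply in_map_iff in Hl; destruct Hl as [u [<- Hu]]; apply in_seq in Hu.
    specialize (Hq i u); simpl; lia.
  - apply in_flat_map in H; destruct H as [i [Hi H]]; apply in_seq in Hi.
    apply in_flat_map in H; destruct H as [j [Hj H]]; apply in_seq in Hj.
    destruct (i <? j); [|destruct H].
    apply in_map_iff in H; destruct H as [u [<- Hu]]; apply in_seq in Hu.
    pose proof (Hq i u); pose proof (Hq j u).
    destruct Hl as [<-|[<-|[]]]; simpl; lia.
  - apply in_flat_map in H; destruct H as [i [Hi H]]; apply in_seq in Hi.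
    apply in_flat_map in H; destruct H as [u [Hu H]]; apply in_seq in Hu.
    apply in_flat_map in H; destruct H as [v [Hv H]]; apply in_seq in Hv.
    destruct (u <? v); [destruct H as [<-|[]]|destruct H].
    pose proof (Hq i u); pose proof (Hq i v).
    destruct Hl as [<-|[<-|[]]]; simpl; lia.
  - apply in_flat_map in H; destruct H as [i [Hi H]]; apply in_seq in Hi.
    apply in_flat_map in H; destruct H as [j [Hj H]]; apply in_seq in Hj.
    destruct (negb (i =? j)); [|destruct H].
    apply in_flat_map in H; destruct H as [u [Hu H]]; apply in_seq in Hu.
    apply in_flat_map in H; destruct H as [v [Hv H]]; apply in_seq in Hv.
    destruct (u <? v); [destruct H as [<-|[]]|destruct H].
    pose proof (Hq i u); pose proof (Hq j v); pose proof (Hp u v).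
    destruct Hl as [<-|[<-|[<-|[]]]]; simpl; lia.
Qed.

Lemma A_true (tau : nat -> bool) (D : clause) : satisfies_A tau -> In D (A_cnf n) ->
  exists l, In l D /\ true_A tau (fst l) (snd l).
Proof.
  intros Hs HD; destruct (Hs D HD) as [l [Hl E]]; exists l; split; trivial.
  destruct (A_lits D l HD Hl); repeat split; trivial.
Qed.

End Formula.

(** * Soundness of LQU+-Res against the interpolant *)

Ltac r1_bounds := unfold is_r1 in *.

Section LQU.

Variables (n m : nat) (gl : list gate).
Hypothesis wf : circuit_wf n m gl.
Local Notation is_q := (is_q n).
Local Notation is_r1 := (is_r1 n m).
Local Notation eval_all := (eval_all n m gl).
Local Notation F := (Phi n m gl).

(** This invariant lets a plain universal literal determine the bit of its variable without conflict
    with another literal of the line. *)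
Definition lqu_one_sign (C : list mlit) : Prop :=
  forall l l', In l C -> In l' C -> is_r1 (mvar l) -> mvar l = mvar l' -> l = l'.

Definition lqu_true_A (tau : nat -> bool) (C : list mlit) : Prop :=
  exists x b, In (ML x b) C /\ true_A n tau x b.

Definition causal (h : nat -> (nat -> bool) -> bool) : Prop :=
  forall u be be', (forall v, v < u -> be v = be' v) -> h u be = h u be'.

(* A merged literal [u*] stands for the equation of [u] with a bit [h u] that
   depends only on the universal variables before [u]. *)
Definition lqu_lit_true (al : nat -> bool) (h : nat -> (nat -> bool) -> bool)
    (be : nat -> bool) (l : mlit) : Prop :=
  match l with
  | ML x b => ~ is_q x /\ eval_all al be x = b
  | MS u => is_r1 u /\ be u = h u be
  end.

Definition lqu_true_B (al : nat -> bool) (C : list mlit) : Prop :=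
  exists h, causal h /\ forall be, exists l, In l C /\ lqu_lit_true al h be l.

Definition lqu_inv (g : (nat -> bool) -> bool) (C : list mlit) : Prop :=
  lqu_one_sign C /\
  (forall tau, satisfies_A n tau -> g tau = false -> lqu_true_A tau C) /\
  (forall al, accepts n m gl al -> g al = true -> lqu_true_B al C).

Lemma mlit_eq_dec (l l' : mlit) : {l = l'} + {l <> l'}.
Proof. decide equality; apply Nat.eq_dec || apply bool_dec. Qed.

(** Overwriting [h u] by the sign of the plain literal on [u] disturbs no starred literal, as [u]
    occurs in one form only. Afterwards plain universal literals also express [be u = h u be], so
    they can be starred later without changing their truth. *)
Lemma lqu_true_B_normal (al : nat -> bool) (C : list mlit) :
  lqu_one_sign C -> lqu_true_B al C ->
  exists h, causal h /\
    (forall u b, is_r1 u -> In (ML u b) C -> forall be, h u be = b) /\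
    forall be, exists l, In l C /\ lqu_lit_true al h be l.
Proof.
  intros Hs [h [Hc Ht]].
  exists (fun u be => if in_dec mlit_eq_dec (ML u true) C then true
                      else if in_dec mlit_eq_dec (ML u false) C then false
                      else h u be).
  split; [|split].
  - intros u be be' E; rewrite (Hc u be be' E); reflexivity.
  - intros u b Hu Hin be.
    destruct (in_dec _ (ML u true) C) as [i|i];
      [|destruct (in_dec _ (ML u false) C) as [j|j]]; destruct b; try tauto.
    now specialize (Hs _ _ i Hin Hu eq_refl).
  - intros be; destruct (Ht be) as [[x b|u] [Hin Hl]];
      [exists (ML x b)|exists (MS u)]; split; trivial.
    destruct Hl as [Hu E]; split; trivial.
    destruct (in_dec _ (ML u true) C) as [i|i];
      [|destruct (in_dec _ (ML u false) C) as [j|j]]; trivial.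
    + now specialize (Hs _ _ i Hin Hu eq_refl).
    + now specialize (Hs _ _ j Hin Hu eq_refl).
Qed.

Lemma lqu_true_B_weaken (al : nat -> bool) (P R : list mlit) :
  lqu_one_sign P -> lqu_true_B al P ->
  (forall l, In l P ->
     (exists x b, l = ML x b /\ (is_q x \/ forall be, eval_all al be x <> b)) \/
     In l R \/ (is_r1 (mvar l) /\ In (MS (mvar l)) R)) ->
  lqu_true_B al R.
Proof.
  intros Hs HP Hl; destruct (lqu_true_B_normal _ _ Hs HP) as [h [Hc [Hn Ht]]].
  exists h; split; trivial; intros be.
  destruct (Ht be) as [l [Hin T]].
  destruct (Hl l Hin) as [[x [b [-> [Hq|Hv]]]]|[HR|[Hu HR]]].
  - now destruct T.
  - now destruct T; destruct (Hv be).
  - eauto.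
  - exists (MS (mvar l)); split; trivial; split; trivial.
    destruct l as [x b|u]; simpl in *; [|apply T].
    rewrite (Hn x b Hu Hin be), <- (eval_all_r1 n m gl al be x Hu); apply T.
Qed.

Fixpoint build (f : nat -> (nat -> bool) -> bool) (k : nat) : nat -> bool :=
  match k with
  | 0 => fun _ => false
  | S k => fun v => if v =? k then f k (build f k) else build f k v
  end.

Lemma build_stable (f : nat -> (nat -> bool) -> bool) (v k : nat) :
  v < k -> build f k v = build f (S v) v.
Proof.
  induction k as [|k IHk]; [lia|]; intros Hv.
  destruct (Nat.eq_dec v k) as [->|Hne]; trivial.
  rewrite <- IHk by lia; simpl.
  now rewrite (proj2 (Nat.eqb_neq _ _) Hne).
Qed.

(** By causality the equation for [be u] refers only to smaller variables, so it is solved by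
    recursion along the prefix. *)
Lemma causal_opposite (h : nat -> (nat -> bool) -> bool) : causal h ->
  exists be, forall u, be u = negb (h u be).
Proof.
  intros Hc; pose (f := fun (u : nat) (be : nat -> bool) => negb (h u be)).
  exists (fun u => build f (S u) u); intros u.
  transitivity (f u (build f u)); [simpl; now rewrite Nat.eqb_refl|].
  unfold f at 1; f_equal; apply Hc; intros v Hv; now rewrite (build_stable f v u Hv).
Qed.

(* A clause without [r2]-literals cannot be true by its universal literals: the
   universal player falsifies them one after the other. *)
Lemma lqu_true_B_red (al : nat -> bool) (P D : list mlit) :
  lqu_one_sign P -> lqu_true_B al P -> lqu_red F P D -> lqu_true_B al D.
Proof.
  intros Hs HP [w [Hw [HPD Hred]]]; apply quniv_r1 in Hw.
  destruct (lqu_true_B_normal _ _ Hs HP) as [h [Hc [Hn Ht]]].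
  destruct (causal_opposite h Hc) as [be Hbe].
  destruct (Ht be) as [[x b|u] [Hin T]].
  - destruct T as [Hq E].
    assert (Hx : ~ is_r1 x).
    { intros Hx; rewrite eval_all_r1, Hbe, (Hn x b Hx Hin be) in E by trivial.
      now destruct b. }
    assert (HD : In (ML x b) D).
    { apply HPD in Hin; destruct Hin as [->|]; trivial; contradiction. }
    (* The side condition puts [x] before a variable of [r1]; being neither in [q] nor in [r1], it
       lies in [p], where its value is the same for all [be']. *)
    specialize (Hred x b HD (proj2 (quniv_r1_false n m gl x) Hx)).
    assert (Hlt : x < b1 n) by (r1_bounds; lia).
    exists h; split; trivial; intros be'; exists (ML x b); split; trivial.
    split; trivial; rewrite eval_all_p in * by trivial; trivial.
  - destruct T as [_ E]; rewrite Hbe in E; now destruct (h u be).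
Qed.

Lemma lqu_inv_red (g : (nat -> bool) -> bool) (P D : list mlit) :
  lqu_red F P D -> lqu_inv g P -> lqu_inv g D.
Proof.
  intros Hr [Hs [HA HB]]; split; [|split].
  - destruct Hr as [w [_ [HPD _]]]; intros l l' Hl Hl'.
    apply Hs; apply HPD; right; trivial.
  - intros tau Ht Hg; destruct (HA tau Ht Hg) as [x [b [Hin T]]].
    exists x, b; split; trivial.
    destruct Hr as [w [Hw [HPD _]]]; apply HPD in Hin; destruct Hin as [->|]; trivial.
    apply quniv_r1 in Hw; destruct T as [T _]; r1_bounds; simpl in *; lia.
  - intros al Ha Hg; apply (lqu_true_B_red al P); auto.
Qed.

(** Clauses of [A] receive the constant 0 and clauses of [B] the constant 1; the condition for the
    opposite value is then vacuous. *)
Lemma lqu_inv_axiom (D : clause) (C : list mlit) : In D (qmat F) ->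
  mseteq C (map (fun l => ML (fst l) (snd l)) D) ->
  exists b, lqu_inv (fun _ => b) C.
Proof.
  intros HD HC.
  assert (HCD : forall x b, In (x, b) D -> In (ML x b) C).
  { intros x b Hin; apply HC, in_map_iff; exists (x, b); auto. }
  assert (HDC : forall l, In l C -> exists l', In l' D /\ l = ML (fst l') (snd l')).
  { intros l Hl; apply HC, in_map_iff in Hl; destruct Hl as [l' [<- Hl']]; eauto. }
  apply in_app_or in HD; destruct HD as [HD|HD].
  - exists false; split; [|split; [|discriminate]].
    + intros l l' Hl _ Hu _; destruct (HDC l Hl) as [l0 [Hl0 ->]].
      destruct (A_lits n D l0 HD Hl0) as [Hlt _]; r1_bounds; simpl in *; lia.
    + intros tau Ht _; destruct (A_true n tau D Ht HD) as [[x b] [Hin T]].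
      exists x, b; auto.
  - exists true; split; [|split; [discriminate|]].
    + intros l l' Hl Hl' Hu He.
      destruct (HDC l Hl) as [l0 [Hl0 ->]]; destruct (HDC l' Hl') as [l1 [Hl1 ->]].
      now rewrite (B_sign n m gl D l0 l1 HD Hl0 Hl1 Hu He).
    + intros al Ha _; exists (fun _ _ => false); split; [intros u be be' _; reflexivity|].
      intros be; destruct (B_sat n m gl wf al be D Ha HD) as [[x b] [Hin E]].
      exists (ML x b); split; [auto|split; trivial].
      exact (B_lits n m gl wf D (x, b) HD Hin).
Qed.

Section Resolution.

Variables (x : nat) (P1 P2 R C1 U1 C2 U2 : list mlit).
Hypotheses (HP1 : mseteq P1 (ML x true :: C1 ++ U1))
  (HP2 : mseteq P2 (ML x false :: C2 ++ U2))
  (Hsep : forall l w, In l (C1 ++ C2) -> In w U1 -> mvar l <> mvar w)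
  (Hcom : forall l1 l2, In l1 C1 -> In l2 C2 -> mvar l1 = mvar l2 ->
     l1 = l2 /\ l1 <> MS (mvar l1))
  (Huniv : forall w, In w (U1 ++ U2) -> is_r1 (mvar w))
  (Hvar : forall u, (exists w, In w U1 /\ mvar w = u) <-> (exists w, In w U2 /\ mvar w = u))
  (Hlt : forall w, In w U1 -> x < mvar w)
  (HR : mseteq R (C1 ++ C2 ++ map (fun w => MS (mvar w)) U1)).

Lemma lqu_in_R (l : mlit) : In l R <->
  In l C1 \/ In l C2 \/ exists w, In w U1 /\ l = MS (mvar w).
Proof.
  rewrite (HR l), !in_app_iff, in_map_iff; split; intros [H|[H|[w H]]]; auto;
    right; right; exists w; intuition.
Qed.

Lemma lqu_in_P1 (l : mlit) : In l P1 -> l = ML x true \/ In l C1 \/ In l U1.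
Proof. intros H; apply HP1 in H; destruct H as [<-|H]; auto; apply in_app_or in H; auto. Qed.

Lemma lqu_in_P2 (l : mlit) : In l P2 -> l = ML x false \/ In l C2 \/ In l U2.
Proof. intros H; apply HP2 in H; destruct H as [<-|H]; auto; apply in_app_or in H; auto. Qed.

Lemma lqu_star_U1 (w : mlit) : In w U1 -> In (MS (mvar w)) R.
Proof. intros H; apply lqu_in_R; eauto. Qed.

Lemma lqu_star_U2 (w : mlit) : In w U2 -> In (MS (mvar w)) R.
Proof.
  intros H; destruct (proj2 (Hvar (mvar w))) as [w' [Hw' <-]]; eauto.
  now apply lqu_star_U1.
Qed.

Lemma lqu_one_sign_res : lqu_one_sign P1 -> lqu_one_sign P2 -> lqu_one_sign R.
Proof.
  intros S1 S2 l l' Hl Hl' Hu He.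
  assert (I1 : forall k, In k C1 -> In k P1).
  { intros k Hk; apply HP1; right; apply in_or_app; auto. }
  assert (I2 : forall k, In k C2 -> In k P2).
  { intros k Hk; apply HP2; right; apply in_or_app; auto. }
  apply lqu_in_R in Hl; apply lqu_in_R in Hl'.
  destruct Hl as [Hl|[Hl|[w [Hw ->]]]]; destruct Hl' as [Hl'|[Hl'|[w' [Hw' ->]]]];
    simpl in *.
  - apply S1; auto.
  - exact (proj1 (Hcom _ _ Hl Hl' He)).
  - now destruct (Hsep l w' (in_or_app _ _ _ (or_introl Hl)) Hw').
  - symmetry; exact (proj1 (Hcom _ _ Hl' Hl (eq_sym He))).
  - apply S2; auto.
  - now destruct (Hsep l w' (in_or_app _ _ _ (or_intror Hl)) Hw').
  - now destruct (Hsep l' w (in_or_app _ _ _ (or_introl Hl')) Hw).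
  - now destruct (Hsep l' w (in_or_app _ _ _ (or_intror Hl')) Hw).
  - now rewrite He.
Qed.

Lemma lqu_true_A_left (tau : nat -> bool) :
  lqu_true_A tau P1 -> ~ true_A n tau x true -> lqu_true_A tau R.
Proof.
  intros [y [b [Hin T]]] Hx; exists y, b; split; trivial.
  apply lqu_in_P1 in Hin; destruct Hin as [E|[Hin|Hin]].
  - injection E as -> ->; contradiction.
  - apply lqu_in_R; auto.
  - specialize (Huniv _ (in_or_app _ _ _ (or_introl Hin))).
    destruct T as [T _]; r1_bounds; simpl in *; lia.
Qed.

Lemma lqu_true_A_right (tau : nat -> bool) :
  lqu_true_A tau P2 -> ~ true_A n tau x false -> lqu_true_A tau R.
Proof.
  intros [y [b [Hin T]]] Hx; exists y, b; split; trivial.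
  apply lqu_in_P2 in Hin; destruct Hin as [E|[Hin|Hin]].
  - injection E as -> ->; contradiction.
  - apply lqu_in_R; auto.
  - specialize (Huniv _ (in_or_app _ _ _ (or_intror Hin))).
    destruct T as [T _]; r1_bounds; simpl in *; lia.
Qed.

Lemma lqu_true_B_left (al : nat -> bool) : lqu_one_sign P1 -> lqu_true_B al P1 ->
  is_q x \/ (forall be, eval_all al be x <> true) -> lqu_true_B al R.
Proof.
  intros Hs H1 Hx; apply (lqu_true_B_weaken al P1); trivial; intros l Hl.
  apply lqu_in_P1 in Hl; destruct Hl as [->|[Hl|Hl]].
  - left; eauto.
  - right; left; apply lqu_in_R; auto.
  - right; right; split; [apply Huniv, in_or_app; auto|now apply lqu_star_U1].
Qed.

Lemma lqu_true_B_right (al : nat -> bool) : lqu_one_sign P2 -> lqu_true_B al P2 ->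
  is_q x \/ (forall be, eval_all al be x <> false) -> lqu_true_B al R.
Proof.
  intros Hs H1 Hx; apply (lqu_true_B_weaken al P2); trivial; intros l Hl.
  apply lqu_in_P2 in Hl; destruct Hl as [->|[Hl|Hl]].
  - left; eauto.
  - right; left; apply lqu_in_R; auto.
  - right; right; split; [apply Huniv, in_or_app; auto|now apply lqu_star_U2].
Qed.

(* A literal merged over the pivot [x] takes its bit from the premise that the
   value of [x] leaves unsatisfied; if [x] is in [r2], nothing is merged. *)
Lemma lqu_true_B_both (al : nat -> bool) :
  lqu_one_sign P1 -> lqu_one_sign P2 -> b1 n <= x ->
  lqu_true_B al P1 -> lqu_true_B al P2 -> lqu_true_B al R.
Proof.
  intros S1 S2 Hx H1 H2.
  destruct (lqu_true_B_normal _ _ S1 H1) as [h1 [Hc1 [Hn1 Ht1]]].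
  destruct (lqu_true_B_normal _ _ S2 H2) as [h2 [Hc2 [Hn2 Ht2]]].
  (* The test [x <? u] always succeeds on merged variables; it makes [h] causal by its very form. A
     variable common to [C1] and [C2] is not starred there, so preferring [h1] on it is harmless. *)
  pose (h := fun (u : nat) (be : nat -> bool) =>
    if in_dec Nat.eq_dec u (map mvar U1)
    then (if x <? u then (if be x then h2 u be else h1 u be) else false)
    else if in_dec Nat.eq_dec u (map mvar C1) then h1 u be else h2 u be).
  assert (Hh : causal h).
  { intros u be be' E; unfold h; rewrite (Hc1 u be be' E), (Hc2 u be be' E).
    destruct (Nat.ltb_spec x u) as [Hxu|]; [rewrite (E x Hxu)|]; reflexivity. }
  assert (HhU : forall w be, In w U1 \/ In w U2 ->
    eval_all al be x = be x /\ h (mvar w) be = if be x then h2 (mvar w) be else h1 (mvar w) be).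
  { intros w be Hw.
    assert (Hw1 : exists w', In w' U1 /\ mvar w' = mvar w).
    { destruct Hw as [Hw|Hw]; [eauto|]; apply Hvar; eauto. }
    destruct Hw1 as [w' [Hw' <-]]; pose proof (Hlt w' Hw') as L.
    pose proof (Huniv w' (in_or_app _ _ _ (or_introl Hw'))) as Hr.
    split; [apply eval_all_r1; r1_bounds; lia|].
    unfold h; rewrite (proj2 (Nat.ltb_lt _ _) L).
    destruct (in_dec Nat.eq_dec (mvar w') (map mvar U1)) as [|N]; trivial.
    destruct N; now apply in_map. }
  assert (HsepC : forall l, In l C1 \/ In l C2 -> ~ In (mvar l) (map mvar U1)).
  { intros l Hl Hin; apply in_map_iff in Hin; destruct Hin as [w [E Hw]].
    apply (Hsep l w); auto; apply in_or_app; trivial. }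
  exists h; split; trivial; intros be.
  destruct (eval_all al be x) eqn:Ex.
  - destruct (Ht2 be) as [l [Hin T]].
    pose proof Hin as Hin'; apply lqu_in_P2 in Hin'; destruct Hin' as [->|[Hl|Hl]].
    + destruct T as [_ T]; congruence.
    + exists l; split; [apply lqu_in_R; auto|].
      destruct l as [y b|u]; trivial; destruct T as [Hu E]; split; trivial.
      rewrite E; unfold h; simpl.
      destruct (in_dec _ u (map mvar U1)) as [i|]; [destruct (HsepC _ (or_intror Hl) i)|].
      destruct (in_dec _ u (map mvar C1)) as [i|]; trivial.
      apply in_map_iff in i; destruct i as [l1 [E1 Hl1]].
      destruct (Hcom _ _ Hl1 Hl E1) as [-> N]; now destruct N.
    + exists (MS (mvar l)); split; [now apply lqu_star_U2|].
      destruct (HhU l be (or_intror Hl)) as [Ev Eh]; rewrite Ev in Ex; rewrite Ex in Eh.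
      pose proof (Huniv l (in_or_app _ _ _ (or_intror Hl))) as Hr.
      split; trivial; rewrite Eh; destruct l as [y b|u]; [|apply T].
      simpl in *; rewrite (Hn2 y b Hr Hin be), <- (eval_all_r1 n m gl al be y Hr); apply T.
  - destruct (Ht1 be) as [l [Hin T]].
    pose proof Hin as Hin'; apply lqu_in_P1 in Hin'; destruct Hin' as [->|[Hl|Hl]].
    + destruct T as [_ T]; congruence.
    + exists l; split; [apply lqu_in_R; auto|].
      destruct l as [y b|u]; trivial; destruct T as [Hu E]; split; trivial.
      rewrite E; unfold h; simpl.
      destruct (in_dec _ u (map mvar U1)) as [i|]; [destruct (HsepC _ (or_introl Hl) i)|].
      destruct (in_dec _ u (map mvar C1)) as [i|N]; trivial.
      destruct N; exact (in_map mvar _ _ Hl).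
    + exists (MS (mvar l)); split; [now apply lqu_star_U1|].
      destruct (HhU l be (or_introl Hl)) as [Ev Eh]; rewrite Ev in Ex; rewrite Ex in Eh.
      pose proof (Huniv l (in_or_app _ _ _ (or_introl Hl))) as Hr.
      split; trivial; rewrite Eh; destruct l as [y b|u]; [|apply T].
      simpl in *; rewrite (Hn1 y b Hr Hin be), <- (eval_all_r1 n m gl al be y Hr); apply T.
Qed.

End Resolution.

Lemma lqu_step_gate (prev : list (list mlit)) (C : list mlit) :
  lqu_step F prev C -> gate_from _ n lqu_inv prev C.
Proof.
  intros [[D [HD HC]]|[[P [HP Hr]]|[P1 [P2 [HP1 [HP2 Hr]]]]]].
  - destruct (lqu_inv_axiom D C HD HC) as [b Hb]; exact (gate_const _ _ _ _ _ b Hb).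
  - apply (gate_copy _ _ _ _ _ P HP); intros g; now apply lqu_inv_red.
  - destruct Hr as (x & C1 & U1 & C2 & U2 & E1 & E2 & _ & Hsep & Hcom & Hun & Hvar
      & Hlt & _ & HR).
    assert (Hun' : forall w, In w (U1 ++ U2) -> is_r1 (mvar w)).
    { intros w Hw; apply (quniv_r1 n m gl); auto. }
    destruct (Nat.ltb_spec x (n * n)) as [Hp|Hnp];
      [|destruct (Nat.ltb_spec x (b1 n)) as [Hq|Hr]].
    + assert (Hb : x < b1 n) by (unfold b1; nia).
      apply (gate_sel _ _ _ _ _ P1 P2 x HP1 HP2 Hp); intros g1 g2 [S1 [A1 B1]] [S2 [A2 B2]].
      split; [eapply lqu_one_sign_res; eauto|split; intros al Hal Hg].
      * apply andb_false_iff in Hg; destruct Hg as [Hg|Hg].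
        -- eapply lqu_true_A_right; eauto; intros [_ [_ T]]; now specialize (T Hp).
        -- apply orb_false_iff in Hg; destruct Hg as [Hx Hg].
           eapply lqu_true_A_left; eauto; intros [_ [T _]]; congruence.
      * apply andb_true_iff in Hg; destruct Hg as [Hg2 Hg]; destruct (al x) eqn:Hx.
        -- eapply lqu_true_B_right; eauto; right; intros be.
           rewrite eval_all_p by trivial; congruence.
        -- eapply lqu_true_B_left; eauto; right; intros be.
           rewrite eval_all_p by trivial; congruence.
    + assert (Hxq : is_q x) by (split; trivial).
      apply (gate_or _ _ _ _ _ P1 P2 HP1 HP2); intros g1 g2 [S1 [A1 B1]] [S2 [A2 B2]].
      split; [eapply lqu_one_sign_res; eauto|split; intros al Hal Hg].
      * apply orb_false_iff in Hg; destruct Hg as [Hg1 Hg2]; destruct (al x) eqn:Hx.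
        -- eapply lqu_true_A_right; eauto; intros [_ [T _]]; congruence.
        -- eapply lqu_true_A_left; eauto; intros [_ [T _]]; congruence.
      * apply orb_true_iff in Hg; destruct Hg as [Hg|Hg].
        -- eapply lqu_true_B_left; eauto.
        -- eapply lqu_true_B_right; eauto.
    + apply (gate_and _ _ _ _ _ P1 P2 HP1 HP2); intros g1 g2 [S1 [A1 B1]] [S2 [A2 B2]].
      split; [eapply lqu_one_sign_res; eauto|split; intros al Hal Hg].
      * apply andb_false_iff in Hg; destruct Hg as [Hg|Hg].
        -- eapply lqu_true_A_left; eauto; intros [T _]; lia.
        -- eapply lqu_true_A_right; eauto; intros [T _]; lia.
      * apply andb_true_iff in Hg; destruct Hg as [Hg1 Hg2].
        eapply lqu_true_B_both; eauto.
Qed.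

Lemma lqu_inv_nil (g : (nat -> bool) -> bool) : lqu_inv g [] ->
  (forall tau, satisfies_A n tau -> g tau = true) /\
  (forall al, accepts n m gl al -> g al = false).
Proof.
  intros [_ [HA HB]]; split; intros al Hal; destruct (g al) eqn:Hg; trivial.
  - destruct (HA al Hal Hg) as [x [b [[] _]]].
  - destruct (HB al Hal Hg) as [h [_ H]]; destruct (H (fun _ => false)) as [l [[] _]].
Qed.

End LQU.

(** * Soundness of IRM-calc against the interpolant *)

Ltac q_bounds := unfold is_q in *.

Section IRM.

Variables (n m : nat) (gl : list gate).
Hypothesis wf : circuit_wf n m gl.
Local Notation is_q := (is_q n).
Local Notation is_r1 := (is_r1 n m).
Local Notation eval_all := (eval_all n m gl).
Local Notation F := (Phi n m gl).

(** Only the value is flexible at a star; the domains must coincide. This is what makes the partial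
    assignments of two premises compatible in [irm_true_B_fit]. *)
Definition fits_value (c : option tri) (v : option bool) : Prop :=
  match c, v with
  | None, None | Some TS, Some _ | Some T0, Some false | Some T1, Some true => True
  | _, _ => False
  end.

Definition fits (s : ann) (e : nat -> option bool) : Prop :=
  forall u, is_r1 u -> fits_value (s u) (e u).

Definition comp_val (e e' : nat -> option bool) (u : nat) : option bool :=
  match e u with Some c => Some c | None => e' u end.

Definition fill (e : nat -> option bool) (be : nat -> bool) (u : nat) : bool :=
  match e u with Some c => c | None => be u end.

(** The value [true] for a star is arbitrary, since a star fits either bit. *)
Definition resolve_stars (s : ann) (u : nat) : option bool :=
  match s u with Some T0 => Some false | Some _ => Some true | None => None end.

Definition irm_lit_true (al : nat -> bool) (e : nat -> option bool) (be : nat -> bool)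
    (l : alit) : Prop :=
  match l with
  | (x, b, s) => ~ is_q x /\ eval_all al (fill e be) x = b /\
      (x < n * n \/ (b1 n + m <= x /\ fits s e))
  end.

Definition irm_true_A (tau : nat -> bool) (C : list alit) : Prop :=
  exists x b s, In (x, b, s) C /\ true_A n tau x b.

(* Once [p] and [q] are fixed, the [r2]-literals of the part of a clause that
   matters all carry instances of a single partial assignment [e], with some of
   its values replaced by [*]. *)
Definition irm_true_B (al : nat -> bool) (C : list alit) : Prop :=
  exists e, forall be, exists l, In l C /\ irm_lit_true al e be l.

Definition irm_inv (g : (nat -> bool) -> bool) (C : list alit) : Prop :=
  (forall tau, satisfies_A n tau -> g tau = false -> irm_true_A tau C) /\
  (forall al, accepts n m gl al -> g al = true -> irm_true_B al C).

Lemma fits_resolve_stars (s : ann) : fits s (resolve_stars s).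
Proof. intros u _; unfold resolve_stars; destruct (s u) as [[]|]; exact I. Qed.

Lemma fits_comp (s s' : ann) (e e' : nat -> option bool) :
  fits s e -> fits s' e' -> fits (compA s s') (comp_val e e').
Proof.
  intros H H' u Hu; specialize (H u Hu); specialize (H' u Hu); unfold compA, comp_val.
  destruct (s u) as [[]|], (e u) as [[]|]; simpl in *; auto; contradiction.
Qed.

Definition inst_lit (t : ann) (l : alit) : alit :=
  match l with (x, b, s) => (x, b, restrictA x (compA s t)) end.

Lemma in_inst (t : ann) (l : alit) (C : list alit) : In l C -> In (inst_lit t l) (inst t C).
Proof. intros H; exact (in_map (inst_lit t) C l H). Qed.

Lemma irm_lit_true_inst (al : nat -> bool) (e e' : nat -> option bool)
    (be be' : nat -> bool) (t : ann) (l : alit) :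
  irm_lit_true al e be l ->
  (forall u, is_r1 u -> fill e be u = fill e' be' u) ->
  (fits (snd l) e -> fits (compA (snd l) t) e') ->
  irm_lit_true al e' be' (inst_lit t l).
Proof.
  destruct l as [[x b] s]; simpl; intros [Hq [Hv Hx]] Hf Hs.
  split; [trivial|split].
  - now rewrite <- (eval_all_ext n m gl al _ _ x Hf).
  - destruct Hx as [Hx|[Hx Hfit]]; auto; right; split; trivial.
    intros u Hu; unfold restrictA.
    rewrite (proj2 (Nat.ltb_lt _ _)) by (r1_bounds; lia); exact (Hs Hfit u Hu).
Qed.

Lemma irm_true_A_inst (tau : nat -> bool) (t : ann) (C : list alit) :
  irm_true_A tau C -> irm_true_A tau (inst t C).
Proof.
  intros [x [b [s [Hin T]]]]; exists x, b; eexists; split; [|exact T].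
  exact (in_inst t _ _ Hin).
Qed.

(** The new partial assignment extends [e] by [t]; the old truth is used at those [be] that already
    agree with [t] outside the domain of [e]. *)
Lemma irm_true_B_inst (al : nat -> bool) (t : ann) (C : list alit) :
  irm_true_B al C -> irm_true_B al (inst t C).
Proof.
  intros [e He]; exists (comp_val e (resolve_stars t)); intros be.
  destruct (He (fill (resolve_stars t) be)) as [l [Hin T]].
  exists (inst_lit t l); split; [now apply in_inst|].
  apply (irm_lit_true_inst _ _ _ _ _ _ _ T).
  - intros u _; unfold fill, comp_val; now destruct (e u).
  - intros Hf; apply fits_comp; [exact Hf|apply fits_resolve_stars].
Qed.

Lemma irm_true_A_incl (tau : nat -> bool) (C D : list alit) :
  incl C D -> irm_true_A tau C -> irm_true_A tau D.
Proof. intros H [x [b [s [Hin T]]]]; exists x, b, s; auto. Qed.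

Lemma irm_true_B_incl (al : nat -> bool) (C D : list alit) :
  incl C D -> irm_true_B al C -> irm_true_B al D.
Proof.
  intros H [e He]; exists e; intros be; destruct (He be) as [l [Hin T]]; eauto.
Qed.

Lemma irm_inv_axiom (D : clause) (C : list alit) : In D (qmat F) ->
  aseteq C (irm_axiom_clause F D) -> exists b, irm_inv (fun _ => b) C.
Proof.
  intros HD HC.
  assert (HCD : forall x b, In (x, b) D -> ~ is_r1 x ->
    In (x, b, restrictA x (axiom_ann F D)) C).
  { intros x b Hin Hx; apply HC, in_map_iff; exists (x, b); split; trivial.
    apply filter_In; split; trivial.
    change (negb (quniv F x) = true); now rewrite (proj2 (quniv_r1_false n m gl x) Hx). }
  apply in_app_or in HD; destruct HD as [HD|HD].
  - exists false; split; [|discriminate].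
    intros tau Ht _; destruct (A_true n tau D Ht HD) as [[x b] [Hin T]].
    exists x, b; eexists; split; [apply HCD; trivial|exact T].
    destruct T as [T _]; r1_bounds; simpl in T; lia.
  - exists true; split; [discriminate|].
    intros al Ha _; exists (resolve_stars (axiom_ann F D)); intros be.
    destruct (B_sat n m gl wf al (fill (resolve_stars (axiom_ann F D)) be) D Ha HD)
      as [[x b] [Hin E]]; simpl in E.
    pose proof (B_lits n m gl wf D (x, b) HD Hin) as Hq; simpl in Hq.
    (* The chosen partial assignment falsifies every universal literal of [D], so the literal that
       is true must survive in the axiom line. *)
    assert (Hx : ~ is_r1 x).
    { intros Hx; rewrite eval_all_r1 in E by trivial.
      assert (Hu : quniv F x = true) by now apply quniv_r1.
      unfold fill, resolve_stars, axiom_ann in E; rewrite Hu in E.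
      assert (Hsame : forall b', In (x, b') D -> b' = b).
      { intros b' Hin'; pose proof (B_sign n m gl D (x, b) (x, b') HD Hin Hin' Hx eq_refl).
        congruence. }
      destruct (existsb (fun l => (fst l =? x) && snd l) D) eqn:Et.
      - apply existsb_exists in Et; destruct Et as [[y c] [Hy Ec]]; simpl in Ec.
        apply andb_true_iff in Ec; destruct Ec as [Ey ->]; apply Nat.eqb_eq in Ey.
        subst y; specialize (Hsame true Hy); congruence.
      - destruct (existsb (fun l => (fst l =? x) && negb (snd l)) D) eqn:Ef.
        + apply existsb_exists in Ef; destruct Ef as [[y c] [Hy Ec]]; simpl in Ec.
          apply andb_true_iff in Ec; destruct Ec as [Ey Ec]; apply Nat.eqb_eq in Ey.
          apply negb_true_iff in Ec; subst y c; specialize (Hsame false Hy); congruence.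
        + destruct b.
          * enough (false = true) by discriminate; rewrite <- Et; apply existsb_exists.
            exists (x, true); split; trivial; simpl; now rewrite Nat.eqb_refl.
          * enough (false = true) by discriminate; rewrite <- Ef; apply existsb_exists.
            exists (x, false); split; trivial; simpl; now rewrite Nat.eqb_refl. }
    eexists; split; [exact (HCD x b Hin Hx)|]; split; [trivial|split; [trivial|]].
    destruct (Nat.lt_ge_cases x (n * n)) as [|Hge]; auto; right.
    assert (Hx2 : b1 n + m <= x) by (q_bounds; r1_bounds; lia).
    split; trivial; intros u Hu; unfold restrictA.
    rewrite (proj2 (Nat.ltb_lt _ _)) by (r1_bounds; lia).
    now apply fits_resolve_stars.
Qed.

Lemma fits_merge (s s' : ann) (e : nat -> option bool) :
  (forall u, s u = None <-> s' u = None) -> fits s e \/ fits s' e -> fits (mergeA s s') e.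
Proof.
  intros Hd H u Hu.
  assert (H' : fits_value (s u) (e u) \/ fits_value (s' u) (e u))
    by (destruct H as [H|H]; auto).
  specialize (Hd u); unfold mergeA.
  destruct (s u) as [[]|], (s' u) as [[]|], (e u) as [[]|]; simpl in *; try tauto;
    destruct Hd as [Hd1 Hd2]; (discriminate (Hd1 eq_refl) || discriminate (Hd2 eq_refl)).
Qed.

Lemma irm_inv_merge (g : (nat -> bool) -> bool) (P C D : list alit) x b (s s' : ann) :
  (forall u, s u = None <-> s' u = None) ->
  aseteq P ((x, b, s) :: (x, b, s') :: D) -> aseteq C ((x, b, mergeA s s') :: D) ->
  irm_inv g P -> irm_inv g C.
Proof.
  intros Hd HP HC [HA HB]; split.
  - intros tau Ht Hg; destruct (HA tau Ht Hg) as [y [c [r [Hin T]]]].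
    apply HP in Hin; destruct Hin as [E|[E|Hin]].
    + injection E as -> -> ->; exists y, c; eexists; split; [|exact T].
      apply HC; left; reflexivity.
    + injection E as -> -> ->; exists y, c; eexists; split; [|exact T].
      apply HC; left; reflexivity.
    + exists y, c, r; split; trivial; apply HC; now right.
  - intros al Ha Hg; destruct (HB al Ha Hg) as [e He]; exists e; intros be.
    destruct (He be) as [l [Hin T]].
    apply HP in Hin; destruct Hin as [<-|[<-|Hin]].
    + exists (x, b, mergeA s s'); split; [apply HC; now left|].
      destruct T as [T1 [T2 [T3|[T3 T4]]]]; repeat split; auto.
      right; split; trivial; apply fits_merge; auto.
    + exists (x, b, mergeA s s'); split; [apply HC; now left|].
      destruct T as [T1 [T2 [T3|[T3 T4]]]]; repeat split; auto.
      right; split; trivial; apply fits_merge; auto.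
    + exists l; split; trivial; apply HC; now right.
Qed.

Section Resolution.

Variables (x : nat) (t xi sg : ann) (P1 P2 R C1 C2 : list alit).
Hypotheses (Dxs : disjA xi sg) (Bt : bin_range t)
  (HP1 : aseteq P1 ((x, true, compA t xi) :: C1))
  (HP2 : aseteq P2 ((x, false, compA t sg) :: C2))
  (HR : aseteq R (inst sg C1 ++ inst xi C2)).

Lemma irm_incl_left : incl (inst sg C1) R.
Proof. intros l Hl; apply HR, in_or_app; auto. Qed.

Lemma irm_incl_right : incl (inst xi C2) R.
Proof. intros l Hl; apply HR, in_or_app; auto. Qed.

Lemma irm_true_A_left (tau : nat -> bool) :
  irm_true_A tau P1 -> ~ true_A n tau x true -> irm_true_A tau R.
Proof.
  intros [y [b [s [Hin T]]]] Hx; apply (irm_true_A_incl _ _ _ irm_incl_left).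
  apply irm_true_A_inst; exists y, b, s; split; trivial.
  apply HP1 in Hin; destruct Hin as [E|]; trivial; injection E as <- <- _; contradiction.
Qed.

Lemma irm_true_A_right (tau : nat -> bool) :
  irm_true_A tau P2 -> ~ true_A n tau x false -> irm_true_A tau R.
Proof.
  intros [y [b [s [Hin T]]]] Hx; apply (irm_true_A_incl _ _ _ irm_incl_right).
  apply irm_true_A_inst; exists y, b, s; split; trivial.
  apply HP2 in Hin; destruct Hin as [E|]; trivial; injection E as <- <- _; contradiction.
Qed.

Lemma irm_true_B_left (al : nat -> bool) (e : nat -> option bool) :
  (forall be, exists l, In l P1 /\ irm_lit_true al e be l) ->
  (forall be, ~ irm_lit_true al e be (x, true, compA t xi)) -> irm_true_B al R.
Proof.
  intros He Hx; apply (irm_true_B_incl _ _ _ irm_incl_left), irm_true_B_inst.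
  exists e; intros be; destruct (He be) as [l [Hin T]]; exists l; split; trivial.
  apply HP1 in Hin; destruct Hin as [<-|]; trivial; now destruct (Hx be).
Qed.

Lemma irm_true_B_right (al : nat -> bool) (e : nat -> option bool) :
  (forall be, exists l, In l P2 /\ irm_lit_true al e be l) ->
  (forall be, ~ irm_lit_true al e be (x, false, compA t sg)) -> irm_true_B al R.
Proof.
  intros He Hx; apply (irm_true_B_incl _ _ _ irm_incl_right), irm_true_B_inst.
  exists e; intros be; destruct (He be) as [l [Hin T]]; exists l; split; trivial.
  apply HP2 in Hin; destruct Hin as [<-|]; trivial; now destruct (Hx be).
Qed.

(** As [xi] and [sg] are disjoint, [e1] and [e2] overlap only on the domain of [t], whose values are
    bits that both must follow; so they have a common extension. Under it one of the two pivots is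
    false, and the true literal of that premise, instantiated by the annotation part of the other,
    fits the extension. *)
Lemma irm_true_B_fit (al : nat -> bool) (e1 e2 : nat -> option bool) :
  fits (compA t xi) e1 -> fits (compA t sg) e2 ->
  (forall be, exists l, In l P1 /\ irm_lit_true al e1 be l) ->
  (forall be, exists l, In l P2 /\ irm_lit_true al e2 be l) -> irm_true_B al R.
Proof.
  intros F1 F2 H1 H2; exists (comp_val e1 e2); intros be.
  assert (Hcomm : forall u, is_r1 u -> comp_val e1 e2 u = comp_val e2 e1 u).
  { intros u Hu; specialize (F1 u Hu); specialize (F2 u Hu).
    specialize (Dxs u); specialize (Bt u).
    unfold comp_val, compA in *.
    destruct (e1 u) as [c1|], (e2 u) as [c2|]; trivial.
    destruct (t u) as [c|].
    - destruct c, c1, c2; simpl in *; trivial; contradiction.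
    - destruct Dxs as [E|E]; rewrite E in *; contradiction. }
  destruct (eval_all al (fill (comp_val e1 e2) be) x) eqn:Ex.
  - destruct (H2 (fill e1 be)) as [l [Hin T]].
    assert (Hf : forall u, is_r1 u -> fill e2 (fill e1 be) u = fill (comp_val e1 e2) be u).
    { intros u Hu; unfold fill at 1 3; rewrite (Hcomm u Hu); unfold comp_val, fill.
      now destruct (e2 u). }
    apply HP2 in Hin; destruct Hin as [<-|Hin].
    { destruct T as [_ [T _]]; rewrite (eval_all_ext n m gl al _ _ x Hf) in T; congruence. }
    exists (inst_lit xi l); split; [now apply irm_incl_right, in_inst|].
    apply (irm_lit_true_inst _ _ _ _ _ _ _ T Hf).
    intros Hl u Hu; rewrite (Hcomm u Hu); specialize (Hl u Hu); specialize (F1 u Hu).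
    specialize (F2 u Hu).
    unfold comp_val, compA in *.
    destruct (snd l u) as [c|], (e2 u) as [c2|]; trivial; try contradiction;
      [now destruct c|].
    destruct (t u) as [c|]; [now destruct c|exact F1].
  - destruct (H1 (fill e2 be)) as [l [Hin T]].
    assert (Hf : forall u, is_r1 u -> fill e1 (fill e2 be) u = fill (comp_val e1 e2) be u).
    { intros u Hu; unfold comp_val, fill; now destruct (e1 u). }
    apply HP1 in Hin; destruct Hin as [<-|Hin].
    { destruct T as [_ [T _]]; rewrite (eval_all_ext n m gl al _ _ x Hf) in T; congruence. }
    exists (inst_lit sg l); split; [now apply irm_incl_left, in_inst|].
    apply (irm_lit_true_inst _ _ _ _ _ _ _ T Hf).
    intros Hl u Hu; specialize (Hl u Hu); specialize (F1 u Hu).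
    specialize (F2 u Hu).
    unfold comp_val, compA in *.
    destruct (snd l u) as [c|], (e1 u) as [c1|]; trivial; try contradiction;
      [now destruct c|].
    destruct (t u) as [c|]; [now destruct c|exact F2].
Qed.

(** If a pivot does not fit the partial assignment of its premise, it is never the true literal
    there, and this premise alone carries over to [R]. *)
Lemma irm_true_B_both (al : nat -> bool) : b1 n <= x ->
  irm_true_B al P1 -> irm_true_B al P2 -> irm_true_B al R.
Proof.
  intros Hx [e1 H1] [e2 H2].
  assert (Hp : ~ x < n * n) by (unfold b1 in Hx; nia).
  destruct (classic (fits (compA t xi) e1)) as [F1|F1].
  - destruct (classic (fits (compA t sg) e2)) as [F2|F2].
    + exact (irm_true_B_fit al e1 e2 F1 F2 H1 H2).
    + apply (irm_true_B_right al e2 H2); intros be [_ [_ [|[_ H]]]]; contradiction.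
  - apply (irm_true_B_left al e1 H1); intros be [_ [_ [|[_ H]]]]; contradiction.
Qed.

Lemma irm_res_gate (prev : list (list alit)) : In P1 prev -> In P2 prev ->
  gate_from _ n irm_inv prev R.
Proof.
  intros I1 I2.
  destruct (Nat.ltb_spec x (n * n)) as [Hp|Hnp];
    [|destruct (Nat.ltb_spec x (b1 n)) as [Hq|Hr]].
  - assert (Hb : x < b1 n) by (unfold b1; nia).
    apply (gate_sel _ _ _ _ _ P1 P2 x I1 I2 Hp); intros g1 g2 [A1 B1] [A2 B2].
    split; intros al Hal Hg.
    + apply andb_false_iff in Hg; destruct Hg as [Hg|Hg].
      * apply irm_true_A_right; auto; intros [_ [_ T]]; now specialize (T Hp).
      * apply orb_false_iff in Hg; destruct Hg as [Hx Hg].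
        apply irm_true_A_left; auto; intros [_ [T _]]; congruence.
    + apply andb_true_iff in Hg; destruct Hg as [Hg2 Hg]; destruct (al x) eqn:Hx.
      * destruct (B2 al Hal Hg2) as [e He]; apply (irm_true_B_right al e He).
        intros be [_ [T _]]; rewrite eval_all_p in T by trivial; congruence.
      * destruct (B1 al Hal Hg) as [e He]; apply (irm_true_B_left al e He).
        intros be [_ [T _]]; rewrite eval_all_p in T by trivial; congruence.
  - assert (Hxq : is_q x) by (split; trivial).
    apply (gate_or _ _ _ _ _ P1 P2 I1 I2); intros g1 g2 [A1 B1] [A2 B2].
    split; intros al Hal Hg.
    + apply orb_false_iff in Hg; destruct Hg as [Hg1 Hg2]; destruct (al x) eqn:Hx.
      * apply irm_true_A_right; auto; intros [_ [T _]]; congruence.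
      * apply irm_true_A_left; auto; intros [_ [T _]]; congruence.
    + apply orb_true_iff in Hg; destruct Hg as [Hg|Hg].
      * destruct (B1 al Hal Hg) as [e He]; apply (irm_true_B_left al e He).
        now intros be [T _].
      * destruct (B2 al Hal Hg) as [e He]; apply (irm_true_B_right al e He).
        now intros be [T _].
  - apply (gate_and _ _ _ _ _ P1 P2 I1 I2); intros g1 g2 [A1 B1] [A2 B2].
    split; intros al Hal Hg.
    + apply andb_false_iff in Hg; destruct Hg as [Hg|Hg].
      * apply irm_true_A_left; auto; intros [T _]; lia.
      * apply irm_true_A_right; auto; intros [T _]; lia.
    + apply andb_true_iff in Hg; destruct Hg as [Hg1 Hg2]; apply irm_true_B_both; auto.
Qed.

End Resolution.

Lemma irm_step_gate (prev : list (list alit)) (C : list alit) :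
  irm_step F prev C -> gate_from _ n irm_inv prev C.
Proof.
  intros [[D [HD HC]]|[[P [t [HP [_ [_ HC]]]]]|[H|H]]].
  - destruct (irm_inv_axiom D C HD HC) as [b Hb]; exact (gate_const _ _ _ _ _ b Hb).
  - apply (gate_copy _ _ _ _ _ P HP); intros g [HA HB].
    assert (Hi : incl (inst t P) C) by (intros l Hl; now apply HC).
    split; intros al Hal Hg.
    + apply (irm_true_A_incl _ _ _ Hi), irm_true_A_inst; auto.
    + apply (irm_true_B_incl _ _ _ Hi), irm_true_B_inst; auto.
  - destruct H as (P1 & P2 & x & t & xi & sg & C1 & C2 & I1 & I2 & _ & _ & Dxs & Bt
      & HP1 & _ & HP2 & _ & HR).
    eapply irm_res_gate; eauto.
  - destruct H as (P & x & b & s & s' & D & HP & Hd & EP & _ & _ & HC).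
    apply (gate_copy _ _ _ _ _ P HP); intros g; now apply (irm_inv_merge g P C D x b s s').
Qed.

Lemma irm_inv_nil (g : (nat -> bool) -> bool) : irm_inv g [] ->
  (forall tau, satisfies_A n tau -> g tau = true) /\
  (forall al, accepts n m gl al -> g al = false).
Proof.
  intros [HA HB]; split; intros al Hal; destruct (g al) eqn:Hg; trivial.
  - destruct (HA al Hal Hg) as [x [b [s [[] _]]]].
  - destruct (HB al Hal Hg) as [e H]; destruct (H (fun _ => false)) as [l [[] _]].
Qed.

End IRM.

(** * The lower bound for refutations *)

Definition q_assignment (n h : nat) (vert : nat -> nat) (x : nat) : bool :=
  if x <? n * n then clique_graph n h vert x
  else vert ((x - n * n) / n) =? (x - n * n) mod n.

Lemma div_mod_pair (n i u : nat) : u < n -> (i * n + u) / n = i /\ (i * n + u) mod n = u.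
Proof.
  intros Hu; split.
  - rewrite Nat.div_add_l by lia; rewrite Nat.div_small by trivial; lia.
  - rewrite Nat.add_comm, Nat.Div0.mod_add; now apply Nat.mod_small.
Qed.

Lemma q_assignment_qv (n h i u : nat) (vert : nat -> nat) : u < n ->
  q_assignment n h vert (qv n i u) = (vert i =? u).
Proof.
  intros Hu; unfold q_assignment, qv.
  rewrite (proj2 (Nat.ltb_ge _ _)) by lia.
  replace (n * n + i * n + u - n * n) with (i * n + u) by lia.
  now destruct (div_mod_pair n i u Hu) as [-> ->].
Qed.

Lemma q_assignment_pv (n h u v : nat) (vert : nat -> nat) : u < n -> v < n ->
  q_assignment n h vert (pv n u v) = clique_graph n h vert (pv n u v).
Proof.
  intros Hu Hv; unfold q_assignment.
  rewrite (proj2 (Nat.ltb_lt _ _)) by (unfold pv; nia); reflexivity.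
Qed.

Lemma q_assignment_sat (n : nat) (vert : nat -> nat) :
  (forall i, i < n / 2 -> vert i < n) -> (forall i j, vert i = vert j -> i = j) ->
  satisfies_A n (q_assignment n (n / 2) vert).
Proof.
  intros Hlt Hinj D H; unfold A_cnf in H; rewrite !in_app_iff in H.
  assert (Hneg : forall i u, u < n -> vert i <> u ->
    q_assignment n (n / 2) vert (qv n i u) = false).
  { intros i u Hu Hne; rewrite q_assignment_qv by trivial; now apply Nat.eqb_neq. }
  destruct H as [H|[H|[H|H]]].
  - apply in_map_iff in H; destruct H as [i [<- Hi]]; apply in_seq in Hi.
    specialize (Hlt i ltac:(lia)).
    exists (qv n i (vert i), true); split.
    + apply in_map_iff; exists (vert i); split; trivial; apply in_seq; lia.
    + simpl; rewrite q_assignment_qv by trivial; apply Nat.eqb_refl.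
  - apply in_flat_map in H; destruct H as [i [Hi H]]; apply in_seq in Hi.
    apply in_flat_map in H; destruct H as [j [Hj H]]; apply in_seq in Hj.
    destruct (Nat.ltb_spec i j); [|destruct H].
    apply in_map_iff in H; destruct H as [u [<- Hu]]; apply in_seq in Hu.
    destruct (Nat.eq_dec (vert i) u) as [E|E].
    + exists (qv n j u, false); split; [right; left; reflexivity|].
      apply Hneg; [lia|]; intros E'; specialize (Hinj i j); lia.
    + exists (qv n i u, false); split; [left; reflexivity|apply Hneg; trivial; lia].
  - apply in_flat_map in H; destruct H as [i [Hi H]]; apply in_seq in Hi.
    apply in_flat_map in H; destruct H as [u [Hu H]]; apply in_seq in Hu.
    apply in_flat_map in H; destruct H as [v [Hv H]]; apply in_seq in Hv.
    destruct (Nat.ltb_spec u v); [destruct H as [<-|[]]|destruct H].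
    destruct (Nat.eq_dec (vert i) u) as [E|E].
    + exists (qv n i v, false); split; [right; left; reflexivity|apply Hneg; lia].
    + exists (qv n i u, false); split; [left; reflexivity|apply Hneg; trivial; lia].
  - apply in_flat_map in H; destruct H as [i [Hi H]]; apply in_seq in Hi.
    apply in_flat_map in H; destruct H as [j [Hj H]]; apply in_seq in Hj.
    destruct (negb (i =? j)); [|destruct H].
    apply in_flat_map in H; destruct H as [u [Hu H]]; apply in_seq in Hu.
    apply in_flat_map in H; destruct H as [v [Hv H]]; apply in_seq in Hv.
    destruct (Nat.ltb_spec u v); [destruct H as [<-|[]]|destruct H].
    destruct (Nat.eq_dec (vert i) u) as [E|E];
      [|exists (qv n i u, false); split; [left; reflexivity|apply Hneg; trivial; lia]].
    destruct (Nat.eq_dec (vert j) v) as [E'|E'];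
      [|exists (qv n j v, false); split; [right; left; reflexivity|apply Hneg; trivial; lia]].
    exists (pv n u v, true); split; [right; right; left; reflexivity|].
    cbn [fst snd]; rewrite q_assignment_pv by lia; unfold clique_graph, pv.
    destruct (div_mod_pair n u v ltac:(lia)) as [-> ->].
    rewrite !andb_true_iff, negb_true_iff, !existsb_seq, Nat.eqb_neq.
    split; [lia|split].
    + exists i; split; [lia|now apply Nat.eqb_eq].
    + exists j; split; [lia|now apply Nat.eqb_eq].
Qed.

Lemma colour_graph_no_clique (n h : nat) (phi : nat -> nat) : 0 < h ->
  (forall u, phi u < h - 1) ->
  ~ has_clique n h (fun u v => colour_graph n phi (pv n u v)).
Proof.
  intros Hh Hphi [S [Hnd [Hlen [Hn Hadj]]]].
  assert (Hinj : forall u v, In u S -> In v S -> u < v -> phi u <> phi v).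
  { intros u v Hu Hv Huv E; specialize (Hadj u v Hu Hv Huv).
    unfold colour_graph, pv in Hadj.
    destruct (div_mod_pair n u v (Hn v Hv)) as [E1 E2]; rewrite E1, E2 in Hadj.
    now rewrite E, Nat.eqb_refl in Hadj. }
  assert (Hmap : NoDup (map phi S)).
  { apply NoDup_map_NoDup_ForallPairs; trivial; intros u v Hu Hv E.
    destruct (Nat.lt_total u v) as [L|[L|L]]; trivial.
    - destruct (Hinj u v Hu Hv L E).
    - destruct (Hinj v u Hv Hu L (eq_sym E)). }
  assert (Hincl : incl (map phi S) (seq 0 (h - 1))).
  { intros c Hc; apply in_map_iff in Hc; destruct Hc as [u [<- _]].
    apply in_seq; specialize (Hphi u); lia. }
  pose proof (NoDup_incl_length Hmap Hincl) as Hle.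
  rewrite length_map, length_seq in Hle; lia.
Qed.

Lemma interpolant_size (n m s len : nat) (gl : list gate) t gs g :
  (forall al, (forall be, circ_out n m gl (fun x => if x <? b1 n then al x else be x) = true)
     <-> ~ has_clique n (n / 2) (fun u v => al (pv n u v))) ->
  2 <= s -> (2 * (s * s) + 1) * (8 * (s * s)) <= n / 2 ->
  mono_prog n t gs -> In g gs -> t <= 2 * len ->
  (forall tau, satisfies_A n tau -> g tau = true) ->
  (forall al, accepts n m gl al -> g al = false) ->
  s <= S (Nat.log2_up len).
Proof.
  intros Hspec Hs Hh Hm Hg Ht HA HB.
  assert (Hn : 2 * (n / 2) <= n) by apply Nat.Div0.mul_div_le.
  assert (Hpos : 0 < n / 2).
  { refine (Nat.lt_le_trans _ _ _ _ Hh); apply Nat.mul_pos_pos; nia. }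
  assert (Hlow : 2 ^ s <= t).
  { apply (mono_clique_lower_bound n (n / 2) s t gs g); trivial.
    - intros vert Hlt Hinj.
      rewrite <- (HA (q_assignment n (n / 2) vert)) by now apply q_assignment_sat.
      apply (mono_prog_ext n t gs Hm g Hg); intros x Hx; unfold q_assignment.
      now rewrite (proj2 (Nat.ltb_lt _ _) Hx).
    - intros phi Hphi; apply HB; intros be; revert be.
      apply Hspec, colour_graph_no_clique; trivial. }
  assert (Hlen : 0 < len) by (assert (2 ^ s <> 0) by (apply Nat.pow_nonzero; lia); lia).
  assert (Hup : len <= 2 ^ Nat.log2_up len).
  (* [Nat.log2_up_spec] starts above 1. *)
  { destruct (Nat.eq_dec len 1) as [->|]; [simpl; lia|apply Nat.log2_up_spec; lia]. }
  apply (Nat.pow_le_mono_r_iff 2); [lia|]; rewrite Nat.pow_succ_r'; lia.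
Qed.

(** The requirement [(2s^2 + 1) * 8s^2 <= n / 2] follows from [48s^4 <= n], because
    [2s^2 + 1 <= 3s^2]. *)
Lemma fourth_root (n : nat) :
  exists s, 48 * (s * s * (s * s)) <= n < 48 * (S s * S s * (S s * S s)).
Proof.
  induction n as [|n [s IH]]; [exists 0; simpl; lia|].
  destruct (Nat.lt_ge_cases (S n) (48 * (S s * S s * (S s * S s)))) as [H|H].
  - exists s; lia.
  - exists (S s); split; [trivial|]; nia.
Qed.

(** From [S s <= l + 2] comes [(S s)^2 <= 2l^2], hence [n < 192l^4], and the two extra powers of [l]
    absorb 192. *)
Lemma sixth_power_bound (n s l : nat) : 30 <= s -> s <= S l ->
  n < 48 * (S s * S s * (S s * S s)) -> n <= l ^ 6.
Proof.
  intros Hs Hl Hn.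
  assert (H1 : S s * S s <= 2 * (l * l)) by nia.
  assert (H2 : S s * S s * (S s * S s) <= 4 * (l * l * (l * l))) by nia.
  assert (H3 : 192 <= l * l) by nia.
  assert (E : l ^ 6 = l * l * (l * l * (l * l))) by (simpl; ring).
  rewrite E; generalize dependent (l * l * (l * l)); intros; nia.
Qed.

Theorem theorem4p2 :
  forall (m : nat -> nat) (circ : nat -> list gate),
    (* polynomial size of the circuits (hence of B_n) *)
    (exists c k, forall n, Nat.Even n -> length (circ n) + m n <= c * n ^ k + c) ->
    (* well-formed circuits over inputs p and r1 *)
    (forall n, Nat.Even n -> circuit_wf n (m n) (circ n)) ->
    (* the circuit checks that the set given by r1 is not a clique, so that
       forall r1 (circuit outputs 1)  iff  G_a has no clique of size n/2 *)
    (forall n, Nat.Even n -> forall alpha : nat -> bool,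
       (forall beta : nat -> bool,
          circ_out n (m n) (circ n)
            (fun x => if x <? b1 n then alpha x else beta x) = true) <->
       ~ has_clique n (n / 2) (fun u v => alpha (pv n u v))) ->
    (* refutations of Phi_n have size 2^(n^(Omega(1))) *)
    exists b N, 0 < b /\
      forall n, N <= n -> Nat.Even n ->
        (forall pi, irm_refutation (Phi n (m n) (circ n)) pi ->
           n <= Nat.log2_up (length pi) ^ b) /\
        (forall pi, lqu_refutation (Phi n (m n) (circ n)) pi ->
           n <= Nat.log2_up (length pi) ^ b).
Proof.
  intros m circ _ Hwf Hspec.
  (* The bound is of fourth-root type; exponent 6 instead of 4 hides its constant once [s >= 30],
     which the threshold guarantees. *)
  exists 6, (48 * (30 * 30 * (30 * 30))); split; [lia|]; intros n Hn Hev.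
  destruct (fourth_root n) as [s [Hs1 Hs2]].
  assert (Hs : 30 <= s).
  { apply Nat.nlt_ge; intros L.
    assert (S s * S s <= 30 * 30) by (apply Nat.mul_le_mono; lia).
    assert (S s * S s * (S s * S s) <= 30 * 30 * (30 * 30)) by (apply Nat.mul_le_mono; trivial).
    lia. }
  assert (Hh : (2 * (s * s) + 1) * (8 * (s * s)) <= n / 2).
  { apply Nat.div_le_lower_bound; [lia|]; refine (Nat.le_trans _ _ _ _ Hs1).
    clear - Hs; assert (1 <= s * s) by nia; generalize dependent (s * s); intros; nia. }
  split; intros pi [Hsteps Hnil].
  - destruct (program_of_proof _ n _ (irm_inv n (m n) (circ n))
      (irm_step_gate n (m n) (circ n) (Hwf n Hev)) [] pi Hsteps) as [t [gs [Ht [Hm Hpi]]]].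
    destruct (Hpi [] Hnil) as [g [Hg Hinv]]; apply irm_inv_nil in Hinv.
    apply (sixth_power_bound n s); trivial.
    apply (interpolant_size n (m n) s (length pi) (circ n) t gs g); trivial;
      [apply (Hspec n Hev)|lia|apply Hinv|apply Hinv].
  - destruct (program_of_proof _ n _ (lqu_inv n (m n) (circ n))
      (lqu_step_gate n (m n) (circ n) (Hwf n Hev)) [] pi Hsteps) as [t [gs [Ht [Hm Hpi]]]].
    destruct (Hpi [] Hnil) as [g [Hg Hinv]]; apply lqu_inv_nil in Hinv.
    apply (sixth_power_bound n s); trivial.
    apply (interpolant_size n (m n) s (length pi) (circ n) t gs g); trivial;
      [apply (Hspec n Hev)|lia|apply Hinv|apply Hinv].
Qed.
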